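(* Let $\mathscr{A}=\varprojlim\mathscr{A}_\alpha$ be a unital locally $C^*$-algebra, $\mathcal{M}$ a Hilbert $\mathscr{A}$-module, and $\mathcal{H},\mathcal{K}$ locally Hilbert spaces with index set $\Delta$. Let $[\varphi]=(\varphi_{ij})_{i,j=1}^n$ be a continuous completely $n$-positive map from $\mathscr{A}$ to $\mathscr{L}(\mathcal{H})$, and let $[\Phi]=(\Phi_{ij})_{i,j=1}^n$, $\Phi_{ij}:\mathcal{M}\to\mathscr{L}(\mathcal{H},\mathcal{K})$, be a $[\varphi]$-completely positive $n\times n$ matrix. Then there exist locally Hilbert spaces $\mathcal{H}^\Phi,\mathcal{K}^\Phi$, a representation $\pi^\Phi:\mathcal{M}\to\mathscr{L}(\mathcal{H}^\Phi,\mathcal{K}^\Phi)$ of $\mathcal{M}$ associated with a continuous $*$-homomorphism $\pi^\varphi:\mathscr{A}\to\mathscr{L}(\mathcal{H}^\Phi)$, and continuous linear operators $S_i^\Phi\in\mathscr{L}(\mathcal{H},\mathcal{H}^\Phi)$ and $W_i^\Phi\in\mathscr{L}(\mathcal{K},\mathcal{K}^\Phi)$, $i=1,\dots,n$, such that: (1) $\varphi_{ij}(a)=(S_i^\Phi)^*\pi^\varphi(a)S_j^\Phi$ for every $a\in\mathscr{A}$ and $i,j\in\{1,\dots,n\}$; (2) $\Phi_{ij}(x)=(W_i^\Phi)^*\pi^\Phi(x)S_j^\Phi$ for every $x\in\mathcal{M}$ and $i,j\in\{1,\dots,n\}$; (3) $\mathcal{H}^\Phi=\big[\bigcup_{i=1}^n\pi^\varphi(\mathscr{A})S_i^\Phi(\mathcal{H})\big]$;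 (4) $\mathcal{K}^\Phi=\big[\bigcup_{i=1}^n\pi^\Phi(\mathcal{M})S_i^\Phi(\mathcal{H})\big]$.
   Context: Locally $C^*$-algebras: a locally $C^*$-algebra $\mathscr{A}$ is a complete Hausdorff topological $*$-algebra whose topology is given by an upward directed family of $C^*$-seminorms; $\mathscr{A}=\varprojlim\mathscr{A}_\alpha$ is an inverse limit of $C^*$-algebras. The directed set $S(\mathscr{A})$ of all continuous $C^*$-seminorms $\|\cdot\|_\alpha$ on $\mathscr{A}$ is assumed to coincide with the index set $\Delta$ of the locally Hilbert spaces. Hilbert modules: a Hilbert $\mathscr{A}$-module $\mathcal{M}$ is a right $\mathscr{A}$-module with an $\mathscr{A}$-valued inner product, $\mathbb{C}$- and $\mathscr{A}$-linear in the second variable, with $\langle y,x\rangle=\langle x,y\rangle^*$ (and positive definite, as usual), complete for the seminorms $\|x\|_\alpha=\|\langle x,x\rangle\|_\alpha^{1/2}$, $\alpha\in\Delta$. Locally Hilbert spaces: for an upward directed set $\Delta$ and Hilbert spaces $\mathcal{H}_\alpha$ with $\mathcal{H}_\alpha$ a closed subspace of $\mathcal{H}_\beta$ for $\alpha\le\beta$, $\mathcal{H}=\varinjlim\mathcal{H}_\alpha=\bigcup_\alpha\mathcal{H}_\alpha$ with the inductive limit locally convex topology is a locally Hilbert space. All locally Hilbert spaces here have index set $\Delta$. $\mathscr{L}(\mathcal{H},\mathcal{K})$ is the set of linear $T:\mathcal{H}\to\mathcal{K}$ with $T(\mathcal{H}_\alpha)\subseteq\mathcal{K}_\alpha$, $T_\alpha:=T|_{\mathcal{H}_\alpha}\in\mathscr{L}(\mathcal{H}_\alpha,\mathcal{K}_\alpha)$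 (bounded operators) for all $\alpha$, and $R_{\alpha\beta}T_\beta=T_\alpha P_{\alpha\beta}$ for $\alpha\le\beta$, where $P_{\alpha\beta}:\mathcal{H}_\beta\to\mathcal{H}_\alpha$ and $R_{\alpha\beta}:\mathcal{K}_\beta\to\mathcal{K}_\alpha$ are the orthogonal projections. The adjoint $T^*\in\mathscr{L}(\mathcal{K},\mathcal{H})$ is given by $T^*|_{\mathcal{K}_\alpha}=T_\alpha^*$. $\mathscr{L}(\mathcal{H},\mathcal{K})$ carries the topology of the seminorms $T\mapsto\|T_\alpha\|$; $\mathscr{L}(\mathcal{H})=\mathscr{L}(\mathcal{H},\mathcal{H})$ is a locally $C^*$-algebra and $\mathscr{L}(\mathcal{H},\mathcal{K})$ is a Hilbert $\mathscr{L}(\mathcal{H})$-module with $\langle T_1,T_2\rangle=T_1^*T_2$. Positivity: a linear map $\varphi:\mathscr{A}\to\mathscr{B}$ of locally $C^*$-algebras is positive if $\varphi(a^*a)\ge0$ for all $a$, and completely positive if all entrywise maps $\mathbb{M}_m(\mathscr{A})\to\mathbb{M}_m(\mathscr{B})$ are positive. A matrix $[\varphi]=(\varphi_{ij})_{i,j=1}^n$ of linear maps $\mathscr{A}\to\mathscr{B}$ is a completely $n$-positive map from $\mathscr{A}$ to $\mathscr{B}$ if $(a_{ij})\mapsto(\varphi_{ij}(a_{ij}))$ is completely positive from $\mathbb{M}_n(\mathscr{A})$ to $\mathbb{M}_n(\mathscr{B})$. An $n\times n$ matrix $[\Phi]=(\Phi_{ij})$ of continuous linear maps $\Phi_{ij}:\mathcal{M}\to\mathscr{L}(\mathcal{H},\mathcal{K})$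 is $[\varphi]$-completely positive, where $[\varphi]$ is a continuous completely $n$-positive map from $\mathscr{A}$ to $\mathscr{L}(\mathcal{H})$, if $\sum_{r=1}^n\Phi_{ri}(x)^*\Phi_{rj}(y)=\varphi_{ij}(\langle x,y\rangle)$ for all $x,y\in\mathcal{M}$ and all $i,j$. A representation of $\mathcal{M}$ on locally Hilbert spaces $\mathcal{H}',\mathcal{K}'$ is a continuous linear map $\Pi:\mathcal{M}\to\mathscr{L}(\mathcal{H}',\mathcal{K}')$ for which there is a continuous $*$-representation $\pi:\mathscr{A}\to\mathscr{L}(\mathcal{H}')$ with $\Pi(x)^*\Pi(y)=\pi(\langle x,y\rangle)$ for all $x,y\in\mathcal{M}$; $\Pi$ is then said to be associated with $\pi$. $[Y]$ denotes the closed linear subspace generated by $Y$. *)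

(* Defs.v *)
From HB Require Import structures.
From mathcomp Require Import all_boot all_order all_algebra.
From mathcomp Require Import complex.
From mathcomp Require Import all_classical all_reals all_analysis.
From mathcomp Require Import lra ring.

Set Implicit Arguments.
Unset Strict Implicit.
Unset Printing Implicit Defensive.

Import Order.TTheory GRing.Theory Num.Theory Num.Def.
Import numFieldNormedType.Exports.

Local Open Scope classical_set_scope.
Local Open Scope ring_scope.
Local Open Scope complex_scope.

Local Notation normc := ComplexField.Normc.normc.

HB.mixin Record PzRing_hasStar A of GRing.PzRing A := {
  star : A -> A;
  starK : involutive star;
  starD : {morph star : x y / x + y};
  starM : forall x y, star (x * y) = star y * star x
}.

#[short(type="starRingType")]
HB.structure Definition StarRing := {A of GRing.PzRing A & PzRing_hasStar A}.

HB.mixin Record StarRing_isStarAlgebra (C : numClosedFieldType) A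
    of StarRing A & GRing.Algebra C A := {
  starZ : forall (c : C) (x : A), star (c *: x) = c^* *: star x
}.

(* algType: the algebra is unital, with 1 != 0. *)
#[short(type="starAlgType")]
HB.structure Definition StarAlgebra (C : numClosedFieldType) :=
  {A of StarRing A & GRing.Algebra C A & StarRing_isStarAlgebra C A}.

(* The involution of M_n(A): (X^* )_ij = (X_ji)^*. *)
Section StarMatrix.
Variables (A : starRingType) (n : nat).

Definition mxstar (X : 'M[A]_n) : 'M[A]_n := \matrix_(i, j) star (X j i).

Lemma star0 : star (0 : A) = 0.
Proof. by apply: (addrI (star (0 : A))); rewrite -starD !addr0. Qed.

Lemma mxstarK : involutive mxstar.
Proof. by move=> X; apply/matrixP => i j; rewrite !mxE starK. Qed.

Lemma mxstarD : {morph mxstar : X Y / X + Y}.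
Proof. by move=> X Y; apply/matrixP => i j; rewrite !mxE starD. Qed.

Lemma mxstarM X Y : mxstar (X * Y) = mxstar Y * mxstar X.
Proof.
apply/matrixP => i j; rewrite !mxE (big_morph star (@starD A) star0).
by apply: eq_bigr => k _; rewrite !mxE starM.
Qed.

HB.instance Definition _ :=
  PzRing_hasStar.Build 'M[A]_n mxstarK mxstarD mxstarM.

End StarMatrix.

(* The positive elements of a (locally) C*-algebra are those of the form b^* b. *)
Definition pos (A : starRingType) (a : A) := exists b : A, a = star b * b.

Definition positive_map (A B : starRingType) (f : A -> B) :=
  forall a : A, pos (f (star a * a)).

Definition completely_positive (A B : starRingType) (f : A -> B) :=
  forall m : nat, positive_map (fun X : 'M[A]_m => map_mx f X : 'M[B]_m).

(* M_m(M_n(A)) is taken literally, as 'M['M[A]_n]_m. *)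
Definition completely_n_positive (A B : starRingType) (n : nat)
    (phi : 'I_n -> 'I_n -> A -> B) :=
  completely_positive
    (fun X : 'M[A]_n => \matrix_(i, j) phi i j (X i j) : 'M[B]_n).

Section SeminormTopology.
Variables (R : realType) (V : lmodType R[i]).

Definition seminorm (p : V -> R) :=
  (forall x y, p (x + y) <= p x + p y) /\
  (forall (c : R[i]) x, p (c *: x) = normc c * p x).

Definition directed_family (P : set (V -> R)) :=
  P !=set0 /\
  forall p q, P p -> P q ->
    exists r, [/\ P r, forall x, p x <= r x & forall x, q x <= r x].

(* The uniformity of the locally convex topology given by P. A single seminorm
   is enough to describe a basic entourage because P will be directed. *)
Definition seminorm_entourage (P : set (V -> R)) : set_system (V * V) :=
  [set E | exists p (e : R),
    [/\ P p, 0 < e & [set xy | p (xy.1 - xy.2) < e] `<=` E]].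

Lemma seminorm0 p : seminorm p -> p 0 = 0.
Proof.
by move=> [_ pZ]; rewrite -(scale0r (0 : V)) pZ ComplexField.Normc.normc0 mul0r.
Qed.

Lemma seminormN p x : seminorm p -> p (- x) = p x.
Proof.
move=> [_ pZ]; rewrite -scaleN1r pZ [normc _](_ : _ = 1) ?mul1r//.
by rewrite /= oppr0 expr0n addr0 sqrrN expr1n sqrtr1.
Qed.

Lemma seminorm_ge0 p x : seminorm p -> 0 <= p x.
Proof.
move=> hp; have := hp.1 x (- x).
by rewrite subrr (seminorm0 hp) (seminormN _ hp) => h; lra.
Qed.

Variable P : set (V -> R).
Hypotheses (Pdir : directed_family P) (Psn : forall p, P p -> seminorm p).

Lemma seminorm_entourage_filter : Filter (seminorm_entourage P).
Proof.
split.
- by have [[p Pp] _] := Pdir; exists p, 1; split.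
- move=> E F [p [e [Pp e0 pE]]] [q [d [Pq d0 qF]]].
  have [r [Pr pr qr]] := Pdir.2 _ _ Pp Pq.
  exists r, (Num.min e d); split; rewrite ?lt_min ?e0//.
  move=> xy /=; rewrite lt_min => /andP[re rd]; split.
    by apply: pE => /=; exact: le_lt_trans (pr _) re.
  by apply: qF => /=; exact: le_lt_trans (qr _) rd.
- move=> E F EF [p [e [Pp e0 pE]]]; exists p, e; split=> //.
  exact: subset_trans EF.
Qed.

Lemma seminorm_entourage_diagonal E :
  seminorm_entourage P E -> diagonal `<=` E.
Proof.
move=> [p [e [Pp e0 pE]]] [x y] exy; have {exy}-> : x = y by []; apply: pE => /=.
by rewrite subrr seminorm0//; exact: Psn.
Qed.

Lemma seminorm_entourage_inv E :
  seminorm_entourage P E -> seminorm_entourage P (E^-1)%relation.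
Proof.
move=> [p [e [Pp e0 pE]]]; exists p, e; split=> // -[x y] /= xy.
by apply: pE => /=; rewrite -opprB seminormN//; exact: Psn.
Qed.

Lemma seminorm_entourage_split E : seminorm_entourage P E ->
  exists2 F, seminorm_entourage P F & (F \; F `<=` E)%relation.
Proof.
move=> [p [e [Pp e0 pE]]].
exists [set xy | p (xy.1 - xy.2) < e / 2].
  by exists p, (e / 2); split; rewrite ?divr_gt0.
move=> [x y] [z /= xz zy]; apply: pE => /=.
rewrite -(subrKA z x) (splitr e); apply: le_lt_trans (ltrD xz zy).
by have [] := Psn Pp.
Qed.

End SeminormTopology.

Section LocallyCstar.
Variables (R : realType) (A : starAlgType R[i]).

Definition Cstar_seminorm (p : A -> R) :=
  [/\ seminorm p, forall a b, p (a * b) <= p a * p b,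
      forall a, p (star a) = p a & forall a, p (star a * a) = p a ^+ 2].

End LocallyCstar.

Definition complete_space (T : uniformType) :=
  forall F : set_system T, ProperFilter F -> cauchy F -> exists x : T, F --> x.

(* Joint continuity of the algebra operations follows from the C*-seminorm
   inequalities, so it is not listed. *)
HB.mixin Record isLocallyCstar (R : realType) A
    of StarAlgebra R[i] A & Uniform A := {
  locCstar_complete : complete_space A;
  locCstar_hausdorff : hausdorff_space A;
  locCstar_topology : exists P : set (A -> R),
    [/\ directed_family P, forall p, P p -> Cstar_seminorm p &
        entourage = seminorm_entourage P]
}.

#[short(type="locCstarType")]
HB.structure Definition LocallyCstar (R : realType) :=
  {A of StarAlgebra R[i] A & Uniform A & isLocallyCstar R A}.

(* Upward directed (nonempty, preordered) sets. *)
Record dirset := Dirset {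
  dir_sort :> Type;
  dir_le : dir_sort -> dir_sort -> Prop;
  dir_refl : forall a, dir_le a a;
  dir_trans : forall a b c, dir_le a b -> dir_le b c -> dir_le a c;
  dir_inh : inhabited dir_sort;
  dir_ub : forall a b, exists c, dir_le a c /\ dir_le b c
}.

Section ContinuousCstarSeminorms.
Variables (R : realType) (A : locCstarType R).

Record cont_Cstar_seminorm := ContCstarSeminorm {
  cs_fun :> A -> R;
  cs_Cstar : Cstar_seminorm cs_fun;
  cs_cont : continuous cs_fun
}.

Definition cs_le (p q : cont_Cstar_seminorm) := forall a, p a <= q a.

Lemma cs0_proof : Cstar_seminorm (fun _ : A => 0 : R).
Proof. by do !split => *; rewrite ?addr0 ?mulr0 ?expr0n. Qed.

Lemma csmax_proof (p q : cont_Cstar_seminorm) :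
  Cstar_seminorm (fun a => maxr (p a) (q a)).
Proof.
have [pD pM ps pC] := cs_Cstar p; have [qD qM qs qC] := cs_Cstar q.
have p0 a : 0 <= p a by exact: seminorm_ge0.
have q0 a : 0 <= q a by exact: seminorm_ge0.
split.
- split=> [x y|c x].
    rewrite ge_max; apply/andP; split.
      by apply: le_trans (pD.1 _ _) _; apply: lerD; rewrite le_max lexx.
    by apply: le_trans (qD.1 _ _) _; apply: lerD; rewrite le_max lexx orbT.
  by rewrite pD.2 qD.2 maxr_pMr//; case: c => a b; exact: sqrtr_ge0.
- move=> a b; rewrite ge_max; apply/andP; split.
    by apply: le_trans (pM _ _) _; apply: ler_pM; rewrite // le_max lexx.
  by apply: le_trans (qM _ _) _; apply: ler_pM; rewrite // le_max lexx orbT.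
- by move=> a; rewrite ps qs.
- move=> a; rewrite pC qC; have [pq|/ltW pq] := leP (p a) (q a).
    by apply/max_r; rewrite ler_sqr ?nnegrE.
  by apply/max_l; rewrite ler_sqr ?nnegrE.
Qed.

Lemma csmax_cont (p q : cont_Cstar_seminorm) :
  continuous (fun a => maxr (p a) (q a)).
Proof.
move=> a; apply: (@continuous_max _ _ (p : A -> R) (q : A -> R));
  exact: cs_cont.
Qed.

Lemma cs_le_trans p q r : cs_le p q -> cs_le q r -> cs_le p r.
Proof. by move=> pq qr a; exact: le_trans (pq a) (qr a). Qed.

Lemma cs_inh : inhabited cont_Cstar_seminorm.
Proof.
by constructor; apply: ContCstarSeminorm cs0_proof _ => a; exact: cvg_cst.
Qed.

Lemma cs_ub p q : exists r, cs_le p r /\ cs_le q r.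
Proof.
exists (ContCstarSeminorm (csmax_proof p q) (@csmax_cont p q)).
by split=> a /=; rewrite le_max lexx ?orbT.
Qed.

(* S(A), the set of all continuous C*-seminorms on A; it is the index set of all
   the locally Hilbert spaces. *)
Definition Sdir : dirset :=
  @Dirset _ cs_le (fun p a => lexx (p a)) cs_le_trans cs_inh cs_ub.

End ContinuousCstarSeminorms.

(* [ract x a] is the right action x a, and [mip x y] the A-valued inner product
   <x, y>, linear in y. *)
HB.mixin Record isHilbertModule (R : realType) (A : locCstarType R) M
    of GRing.Lmodule R[i] M & Uniform M := {
  ract : M -> A -> M;
  ractDl : forall x y a, ract (x + y) a = ract x a + ract y a;
  ractDr : forall x a b, ract x (a + b) = ract x a + ract x b;
  ractA : forall x a b, ract x (a * b) = ract (ract x a) b;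
  ract1 : forall x, ract x 1 = x;
  ractZl : forall (c : R[i]) x a, ract (c *: x) a = c *: ract x a;
  ractZr : forall (c : R[i]) x a, ract x (c *: a) = c *: ract x a;
  mip : M -> M -> A;
  mipDr : forall x y z, mip x (y + z) = mip x y + mip x z;
  mipZr : forall (c : R[i]) x y, mip x (c *: y) = c *: mip x y;
  mipMr : forall x y a, mip x (ract y a) = mip x y * a;
  mipC : forall x y, mip y x = star (mip x y);
  mip_pos : forall x, pos (mip x x);
  mip_eq0 : forall x, mip x x = 0 -> x = 0;
  hilbmod_complete : complete_space M;
  hilbmod_topology : entourage = seminorm_entourage
    (range (fun (p : Sdir A) (x : M) => Num.sqrt (p (mip x x))))
}.

#[short(type="hilbModType")]
HB.structure Definition HilbertModule (R : realType) (A : locCstarType R) :=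
  {M of GRing.Lmodule R[i] M & Uniform M & isHilbertModule R A M}.

Lemma absE (R : rcfType) (c : R[i]) : `|c| = (normc c)%:C.
Proof. by case: c. Qed.

(* A form in {dot U for conjC} is linear in its FIRST variable and conjugate
   linear in the second one. *)
Section InnerProduct.
Variables (R : realType) (U : lmodType R[i]) (f : {dot U for @conjC R[i]}).
Implicit Types (x y z : U) (E : set U).

Definition ipnorm x : R := Num.sqrt (complex.Re (f x x)).

Definition ip_cauchy (u : nat -> U) := forall e : R, 0 < e ->
  exists N, forall m n, (N <= m)%N -> (N <= n)%N -> ipnorm (u m - u n) < e.

Definition ip_cvg (u : nat -> U) x := forall e : R, 0 < e ->
  exists N, forall n, (N <= n)%N -> ipnorm (u n - x) < e.

Definition ip_complete E := forall u : nat -> U,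
  (forall n, E (u n)) -> ip_cauchy u -> exists2 x, E x & ip_cvg u x.

Definition is_subspace E :=
  E 0 /\ forall (c : R[i]) x y, E x -> E y -> E (c *: x + y).

(* y is the orthogonal projection of x on E. *)
Definition is_orthproj E x y := E y /\ forall z, E z -> f z (x - y) = 0.

Local Notation q x := (complex.Re (f x x)).
Local Notation r x y := (complex.Re (f x y)).

Lemma ipC x y : f y x = (f x y)^*%C.
Proof. by rewrite (hermC f y x) expr0 mul1r. Qed.

Lemma ip_ge0 x : 0 <= f x x.
Proof.
have [->|x0] := eqVneq x 0; first by rewrite linear0l.
exact/ltW/neq0_dnorm_gt0.
Qed.

Lemma ipE x : f x x = (q x)%:C.
Proof. by rewrite RRe_real// ger0_real// ip_ge0. Qed.

Lemma qge0 x : 0 <= q x.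
Proof. by rewrite -ler0c -ipE ip_ge0. Qed.

Lemma q_eq0 x : q x = 0 -> x = 0.
Proof.
move=> qx; apply/eqP; apply: contraT => /(neq0_dnorm_gt0 (s := f)).
by rewrite ipE qx ltxx.
Qed.

Lemma ip_eq0 x : f x x = 0 -> x = 0.
Proof. by move=> fx; apply: q_eq0; rewrite fx. Qed.

Lemma rC x y : r y x = r x y.
Proof. by rewrite ipC; case: (f x y). Qed.

Lemma qD x y : q (x + y) = q x + 2 * r x y + q y.
Proof.
rewrite linearDl !linearDr /=. rewrite (ipC x y) /=.
by case: (f x y) => a b; case: (f x x) => ? ?; case: (f y y) => ? ? /=; ring.
Qed.

Lemma rZ (t : R) x y : r (t%:C *: x) y = t * r x y.
Proof. by rewrite linearZl /=; case: (f x y) => a b /=; ring. Qed.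

Lemma ipZZ c x : f (c *: x) (c *: x) = (normc c ^+ 2)%:C * f x x.
Proof.
rewrite linearZl linearZr_LR /= mulrA -[conjC c]/(c^*%C) -sqr_normc absE.
by rewrite rmorphXn.
Qed.

Lemma normc_ge0 (c : R[i]) : 0 <= normc c.
Proof. by case: c => a b; exact: sqrtr_ge0. Qed.

Lemma qZ c x : q (c *: x) = normc c ^+ 2 * q x.
Proof.
rewrite ipZZ; move: (normc c ^+ 2) => t.
by case: (f x x) => a b /=; ring.
Qed.

Lemma ipnorm_ge0 x : 0 <= ipnorm x. Proof. exact: sqrtr_ge0. Qed.

Lemma sqr_ipnorm x : ipnorm x ^+ 2 = q x.
Proof. by rewrite sqr_sqrtr// qge0. Qed.

Lemma ipnormZ c x : ipnorm (c *: x) = normc c * ipnorm x.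
Proof. by rewrite /ipnorm qZ sqrtrM ?sqr_ge0// sqrtr_sqr ger0_norm ?normc_ge0. Qed.

Lemma ipnorm0_eq0 x : ipnorm x = 0 -> x = 0.
Proof. by move=> x0; apply: q_eq0; rewrite -sqr_ipnorm x0 expr0n. Qed.

Lemma ipnorm0 : ipnorm 0 = 0.
Proof. by rewrite /ipnorm linear0l sqrtr0. Qed.

Lemma ipnormN x : ipnorm (- x) = ipnorm x.
Proof. by rewrite /ipnorm linearNl linearNr opprK. Qed.

Lemma ipnormB x y : ipnorm (x - y) = ipnorm (y - x).
Proof. by rewrite -opprB ipnormN. Qed.

Lemma CSr x y : r x y <= ipnorm x * ipnorm y.
Proof.
have [y0|y0] := eqVneq (q y) 0.
  rewrite (q_eq0 y0) linear0r /=.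
  by rewrite ipnorm0 mulr0.
have qy : 0 < q y by rewrite lt_neqAle eq_sym y0 qge0.
have : 0 <= q (x + (- (r x y / q y))%:C *: y) by exact: qge0.
rewrite qD (rC (_ *: y) x) rZ qZ (rC x y).
rewrite [normc _ ^+ 2](_ : _ = (r x y / q y) ^+ 2); last first.
  by rewrite /= expr0n addr0 sqr_sqrtr ?sqr_ge0// sqrrN.
move=> h.
have {}h : (r x y) ^+ 2 <= q x * q y.
  rewrite -ler_pdivrMr//; rewrite -subr_ge0.
  by move: h; congr (_ <= _); field.
have [r0|r0] := ltP (r x y) 0.
  by apply: le_trans (ltW r0) _; rewrite mulr_ge0 ?ipnorm_ge0.
rewrite -(@ler_pXn2r _ 2)// ?nnegrE ?mulr_ge0 ?ipnorm_ge0//.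
by rewrite exprMn !sqr_ipnorm.
Qed.

Lemma ipnormD x y : ipnorm (x + y) <= ipnorm x + ipnorm y.
Proof.
rewrite -(@ler_pXn2r _ 2)// ?nnegrE ?addr_ge0 ?ipnorm_ge0//.
by rewrite sqrrD !sqr_ipnorm qD lerD2r lerD2l; have := CSr x y; lra.
Qed.

Lemma seminorm_ipnorm : seminorm ipnorm.
Proof. by split; [exact: ipnormD|exact: ipnormZ]. Qed.

Lemma CauchySchwarz x y : normc (f x y) <= ipnorm x * ipnorm y.
Proof.
have [->|] := eqVneq (f x y) 0.
  by rewrite ComplexField.Normc.normc0 mulr_ge0// ipnorm_ge0.
move=> c0; set c := f x y.
have nc : 0 < normc c.
  rewrite lt_neqAle normc_ge0 andbT eq_sym; apply: contra c0 => /eqP.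
  by move/ComplexField.Normc.eq0_normc => /eqP.
have := CSr (c^*%C *: x) y.
rewrite linearZl /= -/c mulrC -sqr_normc absE -rmorphXn [complex.Re _]/= ipnormZ.
rewrite (_ : normc c^*%C = normc c); last by case: (c) => a b /=; rewrite sqrrN.
by rewrite expr2 -mulrA ler_pM2l.
Qed.

Lemma orthproj_unique E x y z : is_subspace E ->
  is_orthproj E x y -> is_orthproj E x z -> y = z.
Proof.
move=> [E0 EZ] [Ey yP] [Ez zP]; apply/eqP; rewrite -subr_eq0; apply/eqP.
apply: ip_eq0.
have Eyz : E (y - z) by rewrite addrC -scaleN1r; exact: EZ.
have e : y - z = (x - z) - (x - y) by rewrite opprB [RHS]addrC subrKA.
by rewrite [X in f _ X]e linearBr /= yP// zP// subrr.
Qed.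

Lemma ip_cvg_norm_le (u : nat -> U) x y (d : R) : 0 <= d ->
  (forall e, 0 < e -> exists N, forall n, (N <= n)%N ->
    q (x - u n) <= d + e) -> ip_cvg u y -> q (x - y) <= d.
Proof.
move=> d0 ud uy; apply/ler_addgt0Pr => e e0.
pose s := Num.sqrt (d + e / 2).
have s0 : 0 <= s by exact: sqrtr_ge0.
have s2 : s ^+ 2 = d + e / 2.
  by rewrite sqr_sqrtr// addr_ge0// divr_ge0// ltW.
pose t := Num.min 1 (e / 2 / (2 * s + 1)).
have s1 : 0 < 2 * s + 1 by lra.
have t0 : 0 < t by rewrite lt_min ltr01 divr_gt0// divr_gt0.
have tle : (2 * s + 1) * t <= e / 2.
  by rewrite mulrC -ler_pdivlMr// ge_min lexx orbT.
have t1 : t <= 1 by rewrite ge_min lexx.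
have [N1 uN1] := ud (e / 2) ltac:(by rewrite divr_gt0).
have [N2 uN2] := uy t t0.
pose n := maxn N1 N2.
have h1 : ipnorm (x - u n) <= s.
  by apply: ler_wsqrtr; apply: uN1; rewrite leq_maxl.
have h2 : ipnorm (u n - y) < t by apply: uN2; rewrite leq_maxr.
have h3 : ipnorm (x - y) <= s + t.
  rewrite -(subrKA (u n) x); apply: le_trans (ipnormD _ _) _.
  by rewrite lerD// ltW.
rewrite -sqr_ipnorm; have h0 := ipnorm_ge0 (x - y).
have : ipnorm (x - y) ^+ 2 <= (s + t) ^+ 2 by rewrite ler_sqr// nnegrE; lra.
by move=> /le_trans; apply; nra.
Qed.

Lemma orthproj_ex E x : is_subspace E -> ip_complete E ->
  exists y, is_orthproj E x y.
Proof.
move=> [E0 EZ] Ecpl; pose D := [set q (x - z) | z in E].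
have Dlb : lbound D 0 by move=> _ [z _ <-]; exact: qge0.
have Dinf : has_inf D by split; [exists (q (x - 0)), 0|exists 0].
pose d := inf D.
have d0 : 0 <= d by apply: lb_le_inf => //; case: Dinf.
have dlb z : E z -> d <= q (x - z) by move=> Ez; apply: ge_inf; [case: Dinf|exists z].
have EZ' c z : E z -> E (c *: z) by move=> Ez; rewrite -[_ *: _]addr0; exact: EZ.
have ED z w : E z -> E w -> E (z + w).
  by move=> Ez Ew; rewrite -[z]scale1r; exact: EZ.
have /choice[u uP] n : exists z, E z /\ q (x - z) < d + n.+1%:R^-1.
  have [_ [z Ez <-] h] := @inf_adherent _ D n.+1%:R^-1 ltac:(by []) Dinf.
  by exists z.
have inv_small e : 0 < e -> exists N, forall n, (N <= n)%N -> n.+1%:R^-1 <= e :> R.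
  move=> e0; exists (Num.trunc e^-1) => n Nn.
  rewrite -[leRHS]invrK lef_pV2 ?posrE ?invr_gt0//.
  apply/ltW; apply: lt_le_trans (truncnS_gt _) _.
  by rewrite ler_nat.
have ucauchy : ip_cauchy u.
  move=> e e0; have e20 : 0 < e ^+ 2 / 8 by rewrite divr_gt0// exprn_gt0.
  have [N uN] := inv_small _ e20; exists N => m n Nm Nn.
  have [Em um] := uP m; have [En un] := uP n.
  have := dlb _ (EZ' (2^-1)%:C _ (ED _ _ Em En)).
  have par : q (u m - u n) = 2 * q (x - u m) + 2 * q (x - u n)
      - 4 * q (x - (2^-1)%:C *: (u m + u n)).
    have -> : u m - u n = (x - u n) + (- 1)%:C *: (x - u m).
      by rewrite rmorphN1 scaleN1r opprB [RHS]addrC subrKA.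
    have -> : x - (2^-1)%:C *: (u m + u n) =
        (2^-1)%:C *: ((x - u n) + 1%:C *: (x - u m)).
      rewrite scale1r addrACA -opprD scalerBr (addrC (u n)); congr (_ - _).
      rewrite -mulr2n -(scaler_nat 2 x) scalerA.
      by rewrite -(rmorph_nat (real_complex R) 2) -rmorphM mulVf// scale1r.
    move: (x - u n) (x - u m) => a b.
    rewrite qZ !qD !qZ !(rC (_ *: b) a) !rZ.
    by rewrite /= !expr0n !addr0 !sqr_sqrtr ?sqr_ge0//; field.
  move=> h; rewrite -(@ltr_pXn2r _ 2)// ?nnegrE ?ipnorm_ge0 ?(ltW e0)//.
  rewrite sqr_ipnorm par.
  have := uN _ Nm; have := uN _ Nn.
  by move: (n.+1%:R^-1) (m.+1%:R^-1) um un => a b *; lra.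
have [y Ey uy] := Ecpl u (fun n => (uP n).1) ucauchy.
have qy : q (x - y) <= d.
  apply: (ip_cvg_norm_le d0 _ uy) => e e0.
  have [N uN] := inv_small _ e0; exists N => n Nn.
  by apply/ltW; apply: lt_le_trans (uP n).2 _; rewrite lerD2l uN.
exists y; split=> // z Ez.
have [->|z0] := eqVneq z 0; first by rewrite linear0l.
have qz : 0 < q z.
  by rewrite lt_neqAle qge0 andbT eq_sym; apply: contra z0 => /eqP/q_eq0->.
set c := f z (x - y).
have [//|c0] := eqVneq c 0; exfalso.
pose l : R[i] := (c^*%C) * ((q z)^-1)%:C.
have El : E (y + l *: z) by apply: ED => //; exact: EZ'.
have := le_trans qy (dlb _ El).
rewrite opprD addrA -scaleNr (qD (x - y)) qZ (rC (_ *: z) (x - y)) linearZl /= -/c.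
have nc : 0 < normc c ^+ 2.
  rewrite exprn_gt0// lt_neqAle normc_ge0 andbT eq_sym.
  by apply: contra c0 => /eqP/ComplexField.Normc.eq0_normc/eqP.
have -> : complex.Re (- l * c) = - (normc c ^+ 2 / q z).
  rewrite /l; move: (q z)^-1 => t; case: (c) => a b /=.
  by rewrite sqr_sqrtr ?addr_ge0 ?sqr_ge0//; ring.
have -> : normc (- l) ^+ 2 = normc c ^+ 2 / q z ^+ 2.
  rewrite /l; rewrite -exprVn; move: (q z)^-1 => t; case: (c) => a b /=.
  by rewrite !sqr_sqrtr ?addr_ge0 ?sqr_ge0//; ring.
have : 0 < normc c ^+ 2 / q z by rewrite divr_gt0.
rewrite expr2 invfM mulrA mulfVK ?gt_eqF//; lra.
Qed.

Lemma riesz E (g : U -> R[i]) (M : R) : is_subspace E -> ip_complete E ->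
  (forall c x y, E x -> E y -> g (c *: x + y) = c * g x + g y) ->
  (forall x, E x -> normc (g x) <= M * ipnorm x) ->
  exists2 w, E w & forall x, E x -> g x = f x w.
Proof.
move=> [E0 EZ] Ecpl gZ gM.
have g0 : g 0 = 0.
  have := gZ 1 0 0 E0 E0; rewrite scaler0 addr0 mul1r => /eqP.
  by rewrite -subr_eq0 opprD addrA subrr sub0r oppr_eq0 => /eqP.
have gB x y : E x -> E y -> g (x - y) = g x - g y.
  by move=> Ex Ey; rewrite addrC -scaleN1r gZ// mulN1r addrC.
have EB x y : E x -> E y -> E (x - y).
  by move=> Ex Ey; rewrite addrC -scaleN1r; exact: EZ.
pose N := [set x | E x /\ g x = 0].
have Nsub : is_subspace N.
  split=> // c x y [Ex gx] [Ey gy]; split; first exact: EZ.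
  by rewrite gZ// gx gy mulr0 addr0.
have Ncpl : ip_complete N.
  move=> u uN uc; have [x Ex ux] := Ecpl u (fun n => (uN n).1) uc.
  exists x => //; split=> //; apply: ComplexField.Normc.eq0_normc.
  apply/eqP; rewrite eq_le normc_ge0 andbT; apply/ler_addgt0Pr => e e0.
  rewrite add0r; have M0 : 0 < `|M| + 1 by rewrite ltr_wpDl.
  have [k uk] := ux (e / (`|M| + 1)) ltac:(by rewrite divr_gt0).
  have [Euk guk] := uN k; have := gM _ (EB _ _ Euk Ex).
  rewrite gB// guk sub0r.
  have -> : normc (- g x) = normc (g x) by case: (g x) => a b /=; rewrite !sqrrN.
  move=> h; apply: le_trans h _; have := uk k (leqnn k).
  rewrite ltr_pdivlMr// => h; apply: le_trans (ltW h); rewrite mulrC.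
  rewrite ler_wpM2l ?ipnorm_ge0//; have := ler_norm M; lra.
have [[x0 [Ex0 gx0]]|noN] := pselect (exists x0, E x0 /\ g x0 <> 0); last first.
  exists 0 => // x Ex; rewrite linear0r; apply: contrapT => gx.
  by apply: noN; exists x.
have [y [[Ey gy] yP]] := orthproj_ex x0 Nsub Ncpl.
pose z := x0 - y.
have Ez : E z by exact: EB.
have gz : g z = g x0 by rewrite gB// gy subr0.
have gz0 : g z != 0 by rewrite gz; exact/eqP.
have fz0 : f z z != 0.
  by apply: contra gz0 => /eqP/ip_eq0 ->; rewrite g0.
have EZ' c x : E x -> E (c *: x) by move=> Ex; rewrite -[_ *: _]addr0; exact: EZ.
exists ((g z / f z z)^*%C *: z); first exact: EZ'.
move=> x Ex.
have Nx : N (x - (g x / g z) *: z).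
  split; first by apply: EB => //; exact: EZ'.
  rewrite gB//; last exact: EZ'.
  have -> : g ((g x / g z) *: z) = g x / g z * g z.
    by have := gZ (g x / g z) z 0 Ez E0; rewrite !addr0 g0 addr0.
  by rewrite mulfVK// subrr.
have := yP _ Nx; rewrite -/z linearBl /= linearZl /= => /eqP.
rewrite subr_eq0 => /eqP fxz.
rewrite linearZr_LR /= -[conjC _]/(conjc (conjc _)) conjcK fxz.
by field; rewrite gz0.
Qed.

End InnerProduct.
(* A locally Hilbert space is encoded as the union H (a vector space), the levels
   H_a, which are subspaces of H, and one inner product on H that restricts to
   that of each H_a: since each H_a is a Hilbert subspace of H_b for a <= b and D
   is directed, the inner products of the levels glue. A complete H_a is
   automatically closed in H_b. *)
Record locHilbert (R : realType) (D : dirset) := LocHilbert {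
  lh_lmod : lmodType R[i];
  lh_dot : {dot lh_lmod for @conjC R[i]};
  lh_lvl : D -> set lh_lmod;
  lh_subspace : forall a, is_subspace (lh_lvl a);
  lh_complete : forall a, ip_complete lh_dot (lh_lvl a);
  lh_mono : forall a b, dir_le a b -> lh_lvl a `<=` lh_lvl b;
  lh_cover : forall x, exists a, lh_lvl a x
}.

Definition lh_car (R : realType) (D : dirset) (H : locHilbert R D) : Type :=
  lh_lmod H.
Coercion lh_car : locHilbert >-> Sortclass.

HB.instance Definition _ (R : realType) (D : dirset) (H : locHilbert R D) :=
  GRing.Lmodule.copy (lh_car H) (lh_lmod H).

Section LocHilbertTopology.
Variables (R : realType) (D : dirset) (H : locHilbert R D).

Definition ip (x y : H) : R[i] := lh_dot H x y.
Definition lvl (a : D) : set H := @lh_lvl R D H a.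
Definition hnorm (x : H) : R := ipnorm (lh_dot H) x.

(* The inductive limit topology is the finest locally convex topology for which
   all the inclusions H_a -> H are continuous: it is given by all the seminorms
   whose restriction to each H_a is continuous, i.e. bounded by a multiple of the
   norm of H_a. *)
Definition indlim_seminorms : set (H -> R) := [set p | seminorm p /\
  forall a, exists M : R, forall x, lvl a x -> p x <= M * hnorm x].

Lemma indlim_directed : directed_family indlim_seminorms.
Proof.
split.
  exists (fun=> 0); split; first by split=> *; rewrite ?addr0 ?mulr0.
  by move=> a; exists 0 => x _; rewrite mul0r.
move=> p q [pS pM] [qS qM].
exists (fun x => p x + q x); split=> [|x|x]; last 2 first.
- by rewrite lerDl seminorm_ge0.
- by rewrite lerDr seminorm_ge0.
split.
  split=> [x y|c x]; last by rewrite pS.2 qS.2 mulrDr.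
  by rewrite addrACA lerD ?pS.1 ?qS.1.
move=> a; have [M pxM] := pM a; have [N qxN] := qM a.
by exists (M + N) => x ax; rewrite mulrDl lerD ?pxM ?qxN.
Qed.

Lemma indlim_seminorm p : indlim_seminorms p -> seminorm p.
Proof. by case. Qed.

HB.instance Definition _ := isUniform.Build (lh_car H)
  (seminorm_entourage_filter indlim_directed)
  (seminorm_entourage_diagonal indlim_seminorm)
  (seminorm_entourage_inv indlim_seminorm)
  (seminorm_entourage_split indlim_seminorm).

End LocHilbertTopology.

Section LocHilbertTheory.
Variables (R : realType) (D : dirset) (H : locHilbert R D).
Implicit Types (x y z : H) (a b : D).

(* The orthogonal projection on the level H_a (it exists, see oprojP). *)
Definition oproj a x : H := xget 0 (is_orthproj (lh_dot H) (lvl a) x).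

Lemma oprojP a x : is_orthproj (lh_dot H) (lvl a) x (oproj a x).
Proof.
apply: (@xgetPex _ (0 : H) (is_orthproj (lh_dot H) (lvl a) x)).
exact: (@orthproj_ex _ _ (lh_dot H) _ x (lh_subspace H a) (@lh_complete _ _ H a)).
Qed.

Lemma oproj_eq a x y : is_orthproj (lh_dot H) (lvl a) x y -> oproj a x = y.
Proof.
by move=> yP; apply: (orthproj_unique (lh_subspace H a) (oprojP a x) yP).
Qed.

Lemma lvlZD a (c : R[i]) x y : lvl a x -> lvl a y -> lvl a (c *: x + y).
Proof. by move=> ax ay; exact: (lh_subspace H a).2. Qed.

Lemma lvl0 a : lvl a (0 : H). Proof. exact: (lh_subspace H a).1. Qed.

Lemma lvlZ a (c : R[i]) x : lvl a x -> lvl a (c *: x).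
Proof. by move=> ax; rewrite -[_ *: _]addr0; exact: lvlZD (lvl0 a). Qed.

Lemma ipDl x y z : ip (x + y) z = ip x z + ip y z. Proof. exact: linearDl. Qed.
Lemma ipZl (c : R[i]) x z : ip (c *: x) z = c * ip x z.
Proof. exact: linearZl. Qed.
Lemma ipDr x y z : ip z (x + y) = ip z x + ip z y. Proof. exact: linearDr. Qed.
Lemma ipZr (c : R[i]) x z : ip z (c *: x) = c^* * ip z x.
Proof. exact: linearZr_LR. Qed.
Lemma ip0l z : ip 0 z = 0. Proof. exact: linear0l. Qed.
Lemma ip0r z : ip z 0 = 0. Proof. exact: linear0r. Qed.
Lemma ip_conj x y : ip y x = (ip x y)^*. Proof. exact: ipC. Qed.
Lemma ip_sym0 x y : ip x y = 0 -> ip y x = 0.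
Proof. by move=> xy; rewrite ip_conj xy; exact: conjc0. Qed.
Lemma ipBl x y z : ip (x - y) z = ip x z - ip y z. Proof. exact: linearBl. Qed.
Lemma ipBr x y z : ip z (x - y) = ip z x - ip z y. Proof. exact: linearBr. Qed.

Lemma ip_ext x y : (forall z, ip z x = ip z y) -> x = y.
Proof.
move=> xy; apply/eqP; rewrite -subr_eq0; apply/eqP.
by apply: (@ip_eq0 _ _ (lh_dot H)); rewrite -[LHS]/(ip _ _) ipBr xy subrr.
Qed.

Lemma lvl_common2 x y : exists a, lvl a x /\ lvl a y.
Proof.
have [a ax] := lh_cover x; have [b byy] := lh_cover y.
have [c [ac bc]] := dir_ub a b.
by exists c; split; [exact: lh_mono ac _ ax|exact: lh_mono bc _ byy].
Qed.

End LocHilbertTheory.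

Section LocOp.
Variables (R : realType) (D : dirset) (H K : locHilbert R D).

(* L(H, K); the last clause is R_ab T_b = T_a P_ab. *)
Definition is_locop (T : H -> K) :=
  [/\ forall (c : R[i]) x y, T (c *: x + y) = c *: T x + T y,
      forall a x, lvl a x -> lvl a (T x),
      forall a, exists M : R, forall x, lvl a x -> hnorm (T x) <= M * hnorm x &
      forall a b, dir_le a b -> forall x, lvl b x ->
        oproj a (T x) = T (oproj a x)].

Definition locop_pred : {pred H -> K} := [pred T | `[< is_locop T >]].

Record locop := Locop {locop_fun :> H -> K; locop_in : locop_fun \in locop_pred}.

HB.instance Definition _ := [isSub for locop_fun].
HB.instance Definition _ := [Choice of locop by <:].

Lemma locopP (T : locop) : is_locop T.
Proof. by have := locop_in T => /asboolP. Qed.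

Definition mklocop (T : H -> K) (hT : is_locop T) : locop :=
  Locop (asboolT hT : T \in locop_pred).

Lemma locop_ext (S T : locop) : S =1 T -> S = T.
Proof. by move=> ST; apply: val_inj; apply/funext. Qed.

Lemma is_locop0 : is_locop (0 : H -> K).
Proof.
split=> [c x y|a x _|a|a b _ x _].
- by rewrite scaler0 addr0.
- exact: lvl0.
- by exists 0 => x _; rewrite mul0r /hnorm [X in ipnorm _ X](_ : _ = 0)// ipnorm0.
- by apply: oproj_eq; split=> [|z _]; rewrite ?subrr; [exact: lvl0|exact: ip0r].
Qed.

Lemma is_locopZD (c : R[i]) (S T : H -> K) :
  is_locop S -> is_locop T -> is_locop (c *: S + T).
Proof.
move=> [Slin Slvl Sbd Scom] [Tlin Tlvl Tbd Tcom].
have E x : (c *: S + T) x = c *: S x + T x by [].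
split=> [k x y|a x ax|a|a b ab x bx].
- rewrite !E Slin Tlin !scalerDr !scalerA (mulrC c) -!addrA; congr (_ + _).
  by rewrite addrCA.
- by rewrite E; apply: lvlZD; [exact: Slvl|exact: Tlvl].
- have [M SM] := Sbd a; have [N TN] := Tbd a.
  exists (normc c * M + N) => x ax; rewrite E mulrDl.
  apply: le_trans (ipnormD _ _ _) _; rewrite ipnormZ -mulrA.
  by rewrite lerD ?TN// ler_wpM2l ?normc_ge0// SM.
- rewrite !E; apply: oproj_eq; rewrite -(Scom _ _ ab)// -(Tcom _ _ ab)//.
  have [Sa So] := oprojP a (S x); have [Ta To] := oprojP a (T x).
  split=> [|z az]; first exact: lvlZD.
  rewrite opprD addrACA -scalerBr linearDr linearZr_LR /= So// To//.
  by rewrite mulr0 addr0.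
Qed.

Lemma locop_submod_closed : submod_closed locop_pred.
Proof.
split=> [|c S T]; first by apply/asboolP; exact: is_locop0.
by move=> /asboolP hS /asboolP hT; apply/asboolP; exact: is_locopZD.
Qed.

HB.instance Definition _ :=
  GRing.isSubmodClosed.Build R[i] (H -> K) locop_pred locop_submod_closed.
HB.instance Definition _ := [SubChoice_isSubLmodule of locop by <:].

(* The operator norm of T_a : H_a -> K_a. *)
Definition opnorm (a : D) (T : locop) : R :=
  sup [set hnorm (T x) | x in [set x : H | lvl a x /\ hnorm x <= 1]].

End LocOp.

Section LocOpTopology.
Variables (R : realType) (D : dirset) (H K : locHilbert R D).
Implicit Types (S T : locop H K) (a b : D).

Lemma hnorm_ge0 (X : locHilbert R D) (x : X) : 0 <= hnorm x.
Proof. exact: ipnorm_ge0. Qed.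

Lemma hnorm0 (X : locHilbert R D) : hnorm (0 : X) = 0.
Proof. exact: ipnorm0. Qed.

Lemma locop0 T : T 0 = 0.
Proof.
have [Tlin _ _ _] := locopP T; have := Tlin 1 0 0.
rewrite scaler0 addr0 scale1r => /eqP; rewrite -subr_eq0 opprD addrA subrr.
by rewrite sub0r oppr_eq0 => /eqP.
Qed.

Let opset a T := [set hnorm (T x) | x in [set x : H | lvl a x /\ hnorm x <= 1]].

Lemma opnorm_has_sup a T : has_sup (opset a T).
Proof.
split.
  by exists (hnorm (T 0)), 0 => //; rewrite /= hnorm0; split; [exact: lvl0|].
have [_ _ /(_ a)[M TM] _] := locopP T.
exists `|M| => _ [x [ax x1] <-]; apply: le_trans (TM _ ax) _.
apply: le_trans (ler_norm _) _; rewrite normrM.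
by rewrite ler_piMr// ger0_norm ?hnorm_ge0.
Qed.

Lemma opnorm_ge a T x : lvl a x -> hnorm x <= 1 -> hnorm (T x) <= opnorm a T.
Proof.
move=> ax x1; apply: ub_le_sup; first by case: (opnorm_has_sup a T).
by exists x.
Qed.

Lemma opnorm_le a T M : (forall x, lvl a x -> hnorm x <= 1 -> hnorm (T x) <= M) ->
  opnorm a T <= M.
Proof.
move=> TM; apply: ge_sup; first by case: (opnorm_has_sup a T).
by move=> _ [x [ax x1] <-]; exact: TM.
Qed.

Lemma opnorm_bound a T x : lvl a x -> hnorm (T x) <= opnorm a T * hnorm x.
Proof.
move=> ax; have [x0|x0] := eqVneq (hnorm x) 0.
  by rewrite (ipnorm0_eq0 x0 : x = 0) locop0 !hnorm0 mulr0.
have xgt0 : 0 < hnorm x by rewrite lt_neqAle eq_sym x0 hnorm_ge0.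
have [Tlin _ _ _] := locopP T.
have TZ c y : T (c *: y) = c *: T y by rewrite -[c *: y]addr0 Tlin locop0 addr0.
have nE : normc ((hnorm x)^-1)%:C = (hnorm x)^-1.
  by rewrite /= expr0n addr0 sqrtr_sqr ger0_norm// invr_ge0 hnorm_ge0.
have := @opnorm_ge a T (((hnorm x)^-1)%:C *: x) (lvlZ _ ax).
rewrite TZ /hnorm !ipnormZ nE -!/(hnorm _) mulVf// => /(_ (lexx _)).
by rewrite mulrC ler_pdivrMr.
Qed.

Lemma seminorm_opnorm a : seminorm (@opnorm R D H K a).
Proof.
have le c T : opnorm a (c *: T) <= normc c * opnorm a T.
  apply: opnorm_le => x ax x1.
  rewrite [hnorm _](_ : _ = normc c * hnorm (T x)); last exact: ipnormZ.
  by rewrite ler_wpM2l ?normc_ge0// opnorm_ge.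
split=> [S T|c T].
  apply: opnorm_le => x ax x1; apply: le_trans (ipnormD _ _ _) _.
  by rewrite lerD ?opnorm_ge.
apply/eqP; rewrite eq_le le /=.
have [->|c0] := eqVneq c 0.
  rewrite ComplexField.Normc.normc0 mul0r scale0r.
  apply: le_trans (@opnorm_ge a 0 0 (lvl0 H a) _); last by rewrite hnorm0.
  exact: hnorm_ge0.
have nc : 0 < normc c.
  rewrite lt_neqAle normc_ge0 andbT eq_sym.
  by apply: contra c0 => /eqP/ComplexField.Normc.eq0_normc/eqP.
rewrite mulrC -ler_pdivlMr// mulrC -ComplexField.Normc.normcV.
by rewrite -[X in opnorm a X <= _](scalerK c0) le.
Qed.

Lemma opnorm_mono a b T : dir_le a b -> opnorm a T <= opnorm b T.
Proof.
move=> ab; apply: opnorm_le => x ax x1; apply: opnorm_ge => //.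
exact: lh_mono ab _ ax.
Qed.

Definition opnorms : set (locop H K -> R) := range (@opnorm R D H K).

Lemma opnorms_directed : directed_family opnorms.
Proof.
split; first by have [a] := dir_inh D; exists (opnorm a), a.
move=> _ _ [a _ <-] [b _ <-]; have [c [ac bc]] := dir_ub a b.
by exists (opnorm c); split=> [|T|T]; [exists c| |]; rewrite ?opnorm_mono.
Qed.

Lemma opnorms_seminorm p : opnorms p -> seminorm p.
Proof. by move=> [a _ <-]; exact: seminorm_opnorm. Qed.

HB.instance Definition _ := isUniform.Build (locop H K)
  (seminorm_entourage_filter opnorms_directed)
  (seminorm_entourage_diagonal opnorms_seminorm)
  (seminorm_entourage_inv opnorms_seminorm)
  (seminorm_entourage_split opnorms_seminorm).

End LocOpTopology.

Section LocOpComp.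
Variables (R : realType) (D : dirset) (H K L : locHilbert R D).

Lemma is_locop_comp (S : locop K L) (T : locop H K) : is_locop (S \o T).
Proof.
have [Slin Slvl Sbd Scom] := locopP S; have [Tlin Tlvl Tbd Tcom] := locopP T.
split=> [c x y|a x ax|a|a b ab x bx] /=.
- by rewrite Tlin Slin.
- exact/Slvl/Tlvl.
- have [N TN] := Tbd a; exists (opnorm a S * N) => x ax.
  apply: le_trans (opnorm_bound S (Tlvl _ _ ax)) _; rewrite -mulrA.
  rewrite ler_wpM2l ?TN//; apply: seminorm_ge0; exact: seminorm_opnorm.
- by rewrite (Scom _ _ ab) ?(Tcom _ _ ab)//; exact: Tlvl.
Qed.

Definition lcomp (S : locop K L) (T : locop H K) : locop H L :=
  mklocop (is_locop_comp S T).

End LocOpComp.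

Section Adjoint.
Variables (R : realType) (D : dirset) (H K : locHilbert R D).

Definition is_adjoint (T : locop H K) (S : locop K H) :=
  forall a x y, lvl a x -> lvl a y -> ip (T x) y = ip x (S y).

(* The adjoint exists and is unique, see adjP and adj_unique. *)
Definition adj (T : locop H K) : locop K H := xget 0 (is_adjoint T).

Lemma adjoint_ex T : exists S, is_adjoint T S.
Proof.
have [Tlin Tlvl Tbd Tcom] := locopP T.
have repr a y : lvl a y -> exists w, lvl a w /\ forall x, ip (T x) y = ip x w.
  move=> ay.
  have [c x x' ax ax'|x ax|w aw wP] := @riesz _ _ (lh_dot H) (lvl a)
    (fun x => ip (T x) y) (opnorm a T * hnorm y) (lh_subspace H a)
    (@lh_complete _ _ H a).
  - by rewrite Tlin ipDl ipZl.
  - apply: le_trans (CauchySchwarz _ _ _) _.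
    rewrite -!/(hnorm _) mulrAC ler_wpM2r ?hnorm_ge0//.
    exact: opnorm_bound.
  exists w; split=> // x.
  have [b bx] := lh_cover x; have [c [ac bc]] := dir_ub a b.
  have cx : lvl c x by exact: lh_mono bc _ bx.
  have [Px xP] := oprojP a x; have [PTx TxP] := oprojP a (T x).
  have -> : ip x w = ip (oproj a x) w.
    apply/eqP; rewrite -subr_eq0 -ipBl; apply/eqP/ip_sym0.
    exact: xP w aw.
  have -> : ip (T x) y = ip (oproj a (T x)) y.
    apply/eqP; rewrite -subr_eq0 -ipBl; apply/eqP/ip_sym0.
    exact: TxP y ay.
  by rewrite (Tcom _ _ ac)//; exact: wP.
have /choice[S SP] (y : K) : exists w : H, forall x, ip (T x) y = ip x w.
  by have [a ay] := lh_cover y; have [w [_ wP]] := repr _ _ ay; exists w.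
have Slvl a y : lvl a y -> lvl a (S y).
  move=> ay; have [w [aw wP]] := repr _ _ ay.
  by rewrite (@ip_ext _ _ _ (S y) w)// => x; rewrite -SP wP.
suff hS : is_locop S by exists (mklocop hS) => a x y _ _; exact: SP.
split=> [c x y||a|a b ab y yb].
- by apply: ip_ext => z; rewrite -SP !ipDr !ipZr !SP.
- exact: Slvl.
- exists (opnorm a T) => y ay.
  have [S0|S0] := eqVneq (hnorm (S y)) 0.
    rewrite S0 mulr_ge0 ?hnorm_ge0//; apply: seminorm_ge0.
    exact: seminorm_opnorm.
  have Sgt0 : 0 < hnorm (S y) by rewrite lt_neqAle eq_sym S0 hnorm_ge0.
  rewrite -(ler_pM2l Sgt0) -expr2 [X in X <= _]sqr_ipnorm.
  rewrite -[lh_dot H _ _]/(ip _ _) -SP.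
  apply: (@le_trans _ _ (normc (ip (T (S y)) y))).
    case: (ip _ _) => p q /=; apply: le_trans (ler_norm _) _.
    by rewrite -sqrtr_sqr ler_wsqrtr// lerDl sqr_ge0.
  apply: le_trans (CauchySchwarz _ _ _) _; rewrite -!/(hnorm _).
  rewrite mulrA ler_wpM2r ?hnorm_ge0// mulrC.
  by apply: opnorm_bound; exact: Slvl.
- have [Py yP] := oprojP a y.
  apply: oproj_eq; split=> [|z az]; first exact: Slvl.
  rewrite -[LHS]/(ip _ _) ipBr -!SP -ipBr.
  by apply: yP; exact: Tlvl.
Qed.

Lemma adjP (T : locop H K) x y : ip (T x) y = ip x (adj T y).
Proof.
have h : is_adjoint T (adj T) by apply: xgetPex; exact: adjoint_ex.
have [a ax] := lh_cover x; have [b yb] := lh_cover y.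
have [c [ac bc]] := dir_ub a b.
by apply: (h c); [exact: lh_mono ac _ ax|exact: lh_mono bc _ yb].
Qed.

Lemma adj_unique (T : locop H K) (S : locop K H) :
  (forall x y, ip (T x) y = ip x (S y)) -> adj T = S.
Proof.
move=> TS; apply: locop_ext => y; apply: ip_ext => x.
by rewrite -adjP TS.
Qed.

End Adjoint.

Section LocOpRing.
Variables (R : realType) (D : dirset) (H : locHilbert R D).
Implicit Types S T U : locop H H.

Lemma is_locop_id : is_locop (@idfun H).
Proof.
by split=> //= a; exists 1 => x _; rewrite mul1r.
Qed.

Lemma lcompA : associative (@lcomp R D H H H).
Proof. by move=> S T U; exact: locop_ext. Qed.

Lemma lcomp1l : left_id (mklocop is_locop_id) (@lcomp R D H H H).
Proof. by move=> T; exact: locop_ext. Qed.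

Lemma lcomp1r : right_id (mklocop is_locop_id) (@lcomp R D H H H).
Proof. by move=> T; exact: locop_ext. Qed.

Lemma lcompDl : left_distributive (@lcomp R D H H H) +%R.
Proof. by move=> S T U; exact: locop_ext. Qed.

Lemma locopD T x y : T (x + y) = T x + T y.
Proof. by have [Tlin _ _ _] := locopP T; have := Tlin 1 x y; rewrite !scale1r. Qed.

Lemma lcompDr : right_distributive (@lcomp R D H H H) +%R.
Proof. by move=> S T U; apply: locop_ext => x /=; exact: locopD. Qed.

HB.instance Definition _ := GRing.Zmodule_isPzRing.Build (locop H H)
  lcompA lcomp1l lcomp1r lcompDl lcompDr.

Lemma adjK : involutive (@adj R D H H).
Proof.
move=> T; apply: adj_unique => x y.
by rewrite ip_conj -adjP -ip_conj.
Qed.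

Lemma adjD : {morph @adj R D H H : S T / S + T}.
Proof.
move=> S T; apply: adj_unique => x y.
by rewrite [LHS]ipDl !adjP [RHS]ipDr.
Qed.

Lemma adjM S T : adj (S * T) = adj T * adj S.
Proof. apply: adj_unique => x y.
exact: etrans (adjP S (T x) y) (adjP T x (adj S y)).
Qed.

HB.instance Definition _ := PzRing_hasStar.Build (locop H H) adjK adjD adjM.

End LocOpRing.

(* [Y], the closed linear subspace generated by Y, for the inductive limit
   topology. *)
Definition closed_span (R : realType) (D : dirset) (H : locHilbert R D)
    (Y : set H) : set H :=
  smallest [set E : set H | is_subspace E /\ closed E] Y.

Section Representations.
Variables (R : realType) (A : locCstarType R) (M : hilbModType A).
Variables (H K : locHilbert R (Sdir A)).

Definition continuous_star_rep (pi : {linear A -> locop H H}) :=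
  [/\ continuous pi, forall a b, pi (a * b) = pi a * pi b &
      forall a, pi (star a) = star (pi a)].

(* Pi is a representation of M associated with pi. *)
Definition associated_rep (pi : {linear A -> locop H H})
    (Pi : {linear M -> locop H K}) :=
  [/\ continuous Pi, continuous_star_rep pi &
      forall x y, lcomp (adj (Pi x)) (Pi y) = pi (mip x y)].

Variable n : nat.

Definition continuous_cnp (phi : 'I_n -> 'I_n -> {linear A -> locop H H}) :=
  (forall i j, continuous (phi i j)) /\
  completely_n_positive (fun i j => phi i j : A -> locop H H).

Definition cp_matrix (phi : 'I_n -> 'I_n -> {linear A -> locop H H})
    (Phi : 'I_n -> 'I_n -> {linear M -> locop H K}) :=
  (forall i j, continuous (Phi i j)) /\
  forall i j x y,
    \sum_(r < n) lcomp (adj (Phi r i x)) (Phi r j y) = phi i j (mip x y).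

End Representations.

(* Main.v *)
Require Import Defs.
From HB Require Import structures.
From mathcomp Require Import all_boot all_order all_algebra.
From mathcomp Require Import complex.
From mathcomp Require Import all_classical all_reals all_analysis.
From mathcomp Require Import lra ring.

Set Implicit Arguments.
Unset Strict Implicit.
Unset Printing Implicit Defensive.

Import Order.TTheory GRing.Theory Num.Theory.
Import numFieldNormedType.Exports.

Local Open Scope classical_set_scope.
Local Open Scope ring_scope.

Local Notation normc := ComplexField.Normc.normc.

(* Both spaces come from the Kolmogorov decomposition of a positive definite
   kernel k : Y -> Y -> L(H), that is operators V_y : H -> G with
   V_z^* V_y = k z y whose ranges span G: one completes the span of the functions
   k(., y) h, level by level, and since every k z y commutes with the projections
   on the levels, so does V_y.

   For H^Phi take Y = A x {1..n} and k (b, j) (a, i) = phi_ji (b^* a), positive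
   definite by complete n-positivity, and put S_i = V_(1, i) and
   pi(a) V_(b, i) = V_(a b, i). For K^Phi take Y = M x {1..n} and
   k (y, j) (x, i) = phi_ji <y, x>, which is the Gram kernel of the Phi_ri (x), and
   put Pi(x) V_(b, i) = V'_(x b, i); W_i is the adjoint of V'_(x, j) |-> Phi_ij (x).

   The bound |pi(a)| <= p(a) on a level needs no functional calculus: if p is a
   C*-seminorm with |phi_ij (c)| <= C p(c) on that level, the Schwarz inequality for
   N c = |pi(c) v| gives N(c)^2 <= N(c^* c) N(1), and N <= K p; iterating on
   c = a, a^* a, (a^* a)^2, ... removes the constant K. *)

(** * Inner products from positive definite Hermitian forms *)

(** Antilinearity in the second variable comes from linearity in the first by Hermitian symmetry.
    The sigma type lets definitions take the packed form by [sval], while proofs only see its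
    values. *)
Lemma dot_of (R : realType) (U : lmodType R[i]) (F : U -> U -> R[i]) :
  (forall c x y z, F (c *: x + y) z = c * F x z + F y z) ->
  (forall x y, F y x = (F x y)^*%C) ->
  (forall x, 0 <= F x x) -> (forall x, F x x = 0 -> x = 0) ->
  {f : {dot U for @Num.conj R[i]} | forall x y, f x y = F x y}.
Proof.
move=> Flin Fherm Fge0 F0.
have bil : bilinear_for *%R (Num.conj \; *%R) F.
  split=> [z c x y|z c x y]; first exact: Flin.
  by rewrite Fherm Flin rmorphD rmorphM /= -!Fherm.
have herm x y : F x y = (-1) ^+ false * Num.conj (F y x).
  by rewrite expr0 mul1r Fherm.
have pos x : x != 0 -> 0 < F x x.
  move=> x0; rewrite lt_neqAle Fge0 andbT eq_sym.
  by apply: contra x0 => /eqP/F0->.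
pose B := bilinear_isBilinear.Build R[i] U U R[i] *%R (Num.conj \; *%R) F bil.
pose Hm := isHermitianSesquilinear.Build R[i] U false Num.conj F herm.
pose P := isDotProduct.Build R[i] U F pos.
pose f : {dot U for @Num.conj R[i]} := HB.pack F B Hm P.
by exists f.
Qed.

(** * Limits of complex sequences *)

Lemma invS_small (R : realType) (e : R) : 0 < e ->
  exists N, forall n, (N <= n)%N -> n.+1%:R^-1 <= e.
Proof.
move=> e0; exists (Num.trunc e^-1) => n Nn.
rewrite -[leRHS]invrK lef_pV2 ?posrE ?invr_gt0//.
by apply/ltW; apply: lt_le_trans (truncnS_gt _) _; rewrite ler_nat.
Qed.

Section ComplexSequences.
Variable R : realType.
Implicit Types (z w : nat -> R[i]) (l m c : R[i]) (e : R).

Definition ccvg z l := forall e, 0 < e ->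
  exists N, forall n, (N <= n)%N -> normc (z n - l) < e.

Lemma normcB l m : normc (l - m) = normc (m - l).
Proof. by rewrite -opprB normcN. Qed.

Lemma normc_Re l : `|complex.Re l| <= normc l.
Proof. by case: l => a b /=; rewrite -sqrtr_sqr ler_wsqrtr// lerDl sqr_ge0. Qed.

Lemma normc_Im l : `|complex.Im l| <= normc l.
Proof. by case: l => a b /=; rewrite -sqrtr_sqr ler_wsqrtr// lerDr sqr_ge0. Qed.

Lemma normc_le_ReIm l : normc l <= `|complex.Re l| + `|complex.Im l|.
Proof.
case: l => a b /=; rewrite -(@ler_pXn2r _ 2)// ?nnegrE ?sqrtr_ge0 ?addr_ge0//.
rewrite sqr_sqrtr ?addr_ge0 ?sqr_ge0// sqrrD !real_normK ?num_real//.
by rewrite lerD2r lerDl mulrn_wge0// mulr_ge0.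
Qed.

Lemma ccvg_cst l : ccvg (fun=> l) l.
Proof. by move=> e e0; exists 0%N => n _; rewrite subrr ComplexField.Normc.normc0. Qed.

Lemma ccvg_unique z l m : ccvg z l -> ccvg z m -> l = m.
Proof.
move=> zl zm; apply/eqP; rewrite -subr_eq0; apply/eqP.
apply: ComplexField.Normc.eq0_normc; apply/eqP.
rewrite eq_le normc_ge0 andbT; apply/ler_addgt0Pr => e e0; rewrite add0r.
have e2 : 0 < e / 2 by rewrite divr_gt0.
have [N zN] := zl _ e2; have [N' zN'] := zm _ e2.
have := zN _ (leq_maxl N N'); have := zN' _ (leq_maxr N N').
set n := maxn _ _ => h1 h2; rewrite -(subrKA (z n) l (- m)).
by apply: le_trans (le_normcD _ _) _; rewrite normcB; lra.
Qed.

Lemma ccvgZD c z w l m : ccvg z l -> ccvg w m ->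
  ccvg (fun n => c * z n + w n) (c * l + m).
Proof.
move=> zl wm e e0.
have c0 : 0 < normc c + 1 by rewrite ltr_wpDl ?normc_ge0.
have [N zN] := zl (e / 2 / (normc c + 1)) ltac:(by rewrite !divr_gt0).
have [N' wN'] := wm (e / 2) ltac:(by rewrite divr_gt0).
exists (maxn N N') => n; rewrite geq_max => /andP[/zN h1 /wN' h2].
rewrite opprD addrACA -mulrBr; apply: le_lt_trans (le_normcD _ _) _.
rewrite ComplexField.Normc.normcM [ltRHS]splitr ler_ltD//.
move: h1; rewrite ltr_pdivlMr// => /ltW; apply: le_trans.
by rewrite mulrC ler_wpM2l ?normc_ge0// lerDl.
Qed.

Lemma ccvg_conj z l : ccvg z l -> ccvg (fun n => (z n)^*%C) (l^*%C).
Proof.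
move=> zl e e0; have [N zN] := zl e e0; exists N => n /zN.
by rewrite -rmorphB; case: (z n - l) => a b /=; rewrite sqrrN.
Qed.

Lemma ccvg_near z w l : ccvg z l -> ccvg (fun n => z n - w n) 0 -> ccvg w l.
Proof.
move=> zl zw; have := ccvgZD (-1) zw zl; rewrite mulr0 add0r.
suff -> : (fun n => -1 * (z n - w n) + z n) = w by [].
by apply/funext => n; rewrite mulN1r opprB subrK.
Qed.

Lemma ccvg_Re_le z l (B : R) : ccvg z l ->
  (exists N, forall n, (N <= n)%N -> complex.Re (z n) <= B) -> complex.Re l <= B.
Proof.
move=> zl [N zB]; apply/ler_addgt0Pr => e e0.
have [N' zN'] := zl e e0; have := zN' _ (leq_maxl N' N).
have := zB _ (leq_maxr N' N); set n := maxn _ _ => h1 h2.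
have := le_lt_trans (normc_Re _) h2; rewrite ltr_norml.
by case: (z n) (l) h1 => a b [c d] /=; lra.
Qed.

Lemma ccvg_cauchy z : (forall e, 0 < e -> exists N, forall m n : nat,
    (N <= m)%N -> (N <= n)%N -> normc (z m - z n) < e) -> exists l, ccvg z l.
Proof.
move=> zc.
(* [t] stands for [Re] and for [Im]; both reduce to the completeness of [R]. *)
have real_part (t : R[i] -> R) : (forall x y, t (x - y) = t x - t y) ->
    (forall x, `|t x| <= normc x) ->
    exists l : R, forall e, 0 < e -> exists N, forall n, (N <= n)%N -> `|t (z n) - l| < e.
  move=> tB tn.
  have : cvgn (t \o z).
    apply/cauchy_cvgP/cauchy_exP => e e0; have [N zN] := zc e e0.
    exists (t (z N)), N => // k /= Nk.
    have := tn (z N - z k); rewrite tB => /le_lt_trans; apply; exact: zN.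
  move=> /cvgrPdist_lt tl; exists (limn (t \o z)) => e /tl[N _ Ne].
  by exists N => n /Ne /=; rewrite distrC.
have [a za] := real_part _ (fun x y => raddfB _ x y) normc_Re.
have [b zb] := real_part _ (fun x y => raddfB _ x y) normc_Im.
exists (Complex a b) => e e0; have e2 : 0 < e / 2 by rewrite divr_gt0.
have [N zN] := za _ e2; have [N' zN'] := zb _ e2.
exists (maxn N N') => n; rewrite geq_max => /andP[/zN h1 /zN' h2].
apply: le_lt_trans (normc_le_ReIm _) _; rewrite [ltRHS]splitr.
by case: (z n) h1 h2 => p q /= h1 h2; exact: ltrD.
Qed.

End ComplexSequences.

(** * Completion of an increasing family of pre-Hilbert spaces *)

Record preLocHilbert (R : realType) (D : dirset) := PreLocHilbert {
  pl_lmod : lmodType R[i];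
  pl_dot : {dot pl_lmod for @Num.conj R[i]};
  pl_lvl : D -> set pl_lmod;
  pl_subspace : forall a, is_subspace (pl_lvl a);
  pl_mono : forall a b, dir_le a b -> pl_lvl a `<=` pl_lvl b;
  pl_cover : forall x, exists a, pl_lvl a x
}.

Lemma mul_lt_div (R : realFieldType) (x y B e : R) :
  0 <= x -> 0 < B -> x < e / B -> y <= B -> x * y < e.
Proof.
move=> x0 B0; rewrite ltr_pdivlMr// => xB yB.
by apply: le_lt_trans xB; exact: ler_wpM2l.
Qed.

Section Completion.
Variables (R : realType) (D : dirset) (E : preLocHilbert R D).
Implicit Types (u w : nat -> pl_lmod E) (x y : pl_lmod E) (a b : D).

Local Notation f := (pl_dot E).
Local Notation nrm := (ipnorm f).

Lemma ip_cauchy_bounded u : ip_cauchy f u ->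
  exists (B : R) N, 0 < B /\ forall n, (N <= n)%N -> nrm (u n) <= B.
Proof.
move=> uc; have [N uN] := uc 1 ltr01; exists (1 + nrm (u N)), N; split=> [|n Nn].
  by rewrite ltr_wpDr// ipnorm_ge0.
rewrite -[u n](subrK (u N)); apply: le_trans (ipnormD _ _ _) _.
by rewrite lerD2r ltW// uN.
Qed.

Lemma ip_cauchyZD (c : R[i]) u w : ip_cauchy f u -> ip_cauchy f w ->
  ip_cauchy f (fun n => c *: u n + w n).
Proof.
move=> uc wc e e0.
have c0 : 0 < normc c + 1 by rewrite ltr_wpDl ?normc_ge0.
have [N uN] := uc (e / 2 / (normc c + 1)) ltac:(by rewrite !divr_gt0).
have [N' wN'] := wc (e / 2) ltac:(by rewrite divr_gt0).
exists (maxn N N') => m n; rewrite !geq_max => /andP[Nm N'm] /andP[Nn N'n].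
rewrite opprD addrACA -scalerBr; apply: le_lt_trans (ipnormD _ _ _) _.
rewrite ipnormZ [ltRHS]splitr ler_ltD ?wN'//.
have := uN _ _ Nm Nn; rewrite ltr_pdivlMr// => /ltW; apply: le_trans.
by rewrite mulrC ler_wpM2l ?ipnorm_ge0// lerDl.
Qed.

Lemma ip_cauchy_cst x : ip_cauchy f (fun=> x).
Proof. by move=> e e0; exists 0%N => m n _ _; rewrite subrr ipnorm0. Qed.

(** Both sequences are bounded, so splitting the difference of two terms and applying Cauchy-Schwarz
    to each half shows that the inner products form a Cauchy sequence. *)
Lemma ccvg_ip_ex u w : ip_cauchy f u -> ip_cauchy f w ->
  exists l, ccvg (fun n => f (u n) (w n)) l.
Proof.
move=> uc wc; apply: ccvg_cauchy => e e0.
have [B [N [B0 uB]]] := ip_cauchy_bounded uc.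
have [B' [N' [B'0 wB']]] := ip_cauchy_bounded wc.
have [M uM] := uc (e / 2 / B') ltac:(by rewrite !divr_gt0).
have [M' wM'] := wc (e / 2 / B) ltac:(by rewrite !divr_gt0).
exists (maxn (maxn N N') (maxn M M')) => m n.
rewrite !geq_max -!andbA => /and4P[Nm N'm Mm M'm] /and4P[Nn N'n Mn M'n].
have -> : f (u m) (w m) - f (u n) (w n) =
    f (u m - u n) (w m) + f (u n) (w m - w n).
  by rewrite linearBl linearBr /= subrKA.
apply: le_lt_trans (le_normcD _ _) _; rewrite [ltRHS]splitr; apply: ltrD.
  apply: le_lt_trans (Defs.CauchySchwarz _ _ _) _.
  by apply: (@mul_lt_div _ _ _ B'); rewrite ?ipnorm_ge0 ?uM ?wB'.
apply: le_lt_trans (Defs.CauchySchwarz _ _ _) _; rewrite mulrC.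
by apply: (@mul_lt_div _ _ _ B); rewrite ?ipnorm_ge0 ?wM' ?uB.
Qed.

(** Weak convergence applies to fixed vectors only, so [w n] is replaced by a fixed [w M]; the error
    is small uniformly in [n] because [u] is bounded. This makes the inner product of the completion
    independent of representatives. *)
Lemma ccvg_ip0 u w : (forall y, ccvg (fun n => f (u n) y) 0) ->
  ip_cauchy f u -> ip_cauchy f w -> ccvg (fun n => f (u n) (w n)) 0.
Proof.
move=> u0 uc wc e e0.
have [B [N [B0 uB]]] := ip_cauchy_bounded uc.
have [M wM] := wc (e / 2 / B) ltac:(by rewrite !divr_gt0).
have [M' uM'] := u0 (w M) (e / 2) ltac:(by rewrite divr_gt0).
exists (maxn (maxn N M) M') => n; rewrite !geq_max -andbA => /and3P[Nn Mn M'n].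
have -> : f (u n) (w n) - 0 = f (u n) (w n - w M) + (f (u n) (w M) - 0).
  by rewrite linearBr /= !subr0 subrK.
apply: le_lt_trans (le_normcD _ _) _; rewrite [ltRHS]splitr.
apply: ltrD; last exact: uM'.
apply: le_lt_trans (Defs.CauchySchwarz _ _ _) _; rewrite mulrC.
by apply: (@mul_lt_div _ _ _ B); rewrite ?ipnorm_ge0 ?wM ?uB.
Qed.

(** Two Cauchy sequences with the same limit functional differ by a weakly null sequence, so
    functionals replace a quotient by null sequences. *)
Definition represents u (g : pl_lmod E -> R[i]) :=
  ip_cauchy f u /\ forall y, ccvg (fun n => f (u n) y) (g y).

Lemma representsZD (c : R[i]) u w g h : represents u g -> represents w h ->
  represents (fun n => c *: u n + w n) (c *: g + h).
Proof.
move=> [uc ug] [wc wh]; split=> [|y]; first exact: ip_cauchyZD.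
have -> : (fun n => f (c *: u n + w n) y) = (fun n => c * f (u n) y + f (w n) y).
  by apply/funext => n; rewrite linearPl.
exact: ccvgZD.
Qed.

Lemma representsB u w g h : represents u g -> represents w h ->
  represents (fun n => u n - w n) (g - h).
Proof.
move=> ug wh; have := representsZD (-1) wh ug; rewrite scaleN1r addrC.
by congr represents; apply/funext => n; rewrite scaleN1r addrC.
Qed.

Lemma represents_cst x : represents (fun=> x) (f x).
Proof. by split=> [|y]; [exact: ip_cauchy_cst|exact: ccvg_cst]. Qed.

(* An element of the completion is encoded as the antilinear functional
   [y |-> lim f (u n) y] given by a Cauchy sequence u lying in one level. *)
Definition in_completion a (g : pl_lmod E -> R[i]) :=
  exists u, (forall n, pl_lvl a (u n)) /\ represents u g.

Definition completion_pred : {pred pl_lmod E -> R[i]} :=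
  [pred g | `[< exists a, in_completion a g >]].

Record completion :=
  Completion {completion_fun :> pl_lmod E -> R[i];
              completion_in : completion_fun \in completion_pred}.

HB.instance Definition _ := [isSub for completion_fun].
HB.instance Definition _ := [Choice of completion by <:].

Lemma in_completion0 a : in_completion a 0.
Proof.
exists (fun=> 0); split=> [n|]; first exact: (pl_subspace E a).1.
by have := represents_cst 0; congr represents; apply/funext => y; rewrite linear0l.
Qed.

Lemma in_completionZD a (c : R[i]) g h :
  in_completion a g -> in_completion a h -> in_completion a (c *: g + h).
Proof.
move=> [u [ua ug]] [w [wa wh]]; exists (fun n => c *: u n + w n); split=> [n|].
  exact: (pl_subspace E a).2.
exact: representsZD.
Qed.

Lemma in_completion_mono a b g :
  dir_le a b -> in_completion a g -> in_completion b g.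
Proof.
by move=> ab [u [ua ug]]; exists u; split=> // n; exact: pl_mono ab _ (ua n).
Qed.

Lemma completion_submod_closed : submod_closed completion_pred.
Proof.
split=> [|c g h].
  by have [a] := dir_inh D; apply/asboolP; exists a; exact: in_completion0.
move=> /asboolP[a ga] /asboolP[b hb]; apply/asboolP.
have [d [ad bd]] := dir_ub a b; exists d.
by apply: in_completionZD; [exact: in_completion_mono ad ga
                           |exact: in_completion_mono bd hb].
Qed.

HB.instance Definition _ := GRing.isSubmodClosed.Build R[i]
  (pl_lmod E -> R[i]) completion_pred completion_submod_closed.
HB.instance Definition _ := [SubChoice_isSubLmodule of completion by <:].

Implicit Types (g h : completion).

Lemma completion_ex g : exists a, in_completion a g.
Proof. by have := completion_in g => /asboolP. Qed.

Lemma completion_repr g : exists u, represents u g.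
Proof. by have [a [u [_ ug]]] := completion_ex g; exists u. Qed.

Definition cdot g h : R[i] := xget 0 [set l | forall u w,
  represents u g -> represents w h -> ccvg (fun n => f (u n) (w n)) l].

(** The difference of two representatives represents 0, hence is weakly null, and [ccvg_ip0] lets
    one replace first [u] and then [w] without changing the limit. *)
Lemma cdotP g h u w : represents u g -> represents w h ->
  ccvg (fun n => f (u n) (w n)) (cdot g h).
Proof.
move: u w; apply: (@xgetPex _ 0 [set l | forall u w,
  represents u g -> represents w h -> ccvg (fun n => f (u n) (w n)) l]).
have [u ug] := completion_repr g; have [w wh] := completion_repr h.
have [l ul] := ccvg_ip_ex ug.1 wh.1; exists l => u' w' ug' wh'.
have [dc d0] := representsB ug ug'; rewrite subrr in d0.
have [dc' d0'] := representsB wh wh'; rewrite subrr in d0'.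
have h1 : ccvg (fun n => f (u' n) (w n)) l.
  apply: (ccvg_near ul); have := ccvg_ip0 d0 dc wh.1.
  by congr ccvg; apply/funext => n; rewrite linearBl.
apply: (ccvg_near h1); have := ccvg_conj (ccvg_ip0 d0' dc' ug'.1); rewrite conjc0.
congr ccvg; apply/funext => n; rewrite linearBl /= rmorphB /=.
by rewrite -!ipC.
Qed.

Lemma cdotPl (c : R[i]) g g' h : cdot (c *: g + g') h = c * cdot g h + cdot g' h.
Proof.
have [u ug] := completion_repr g; have [w wh] := completion_repr h.
have [u' ug'] := completion_repr g'.
apply: ccvg_unique (cdotP (representsZD c ug ug' : represents _ (c *: g + g')) wh) _.
have := ccvgZD c (cdotP ug wh) (cdotP ug' wh).
by congr ccvg; apply/funext => n; rewrite linearPl.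
Qed.

Lemma cdotC g h : cdot h g = (cdot g h)^*%C.
Proof.
have [u ug] := completion_repr g; have [w wh] := completion_repr h.
apply: ccvg_unique (cdotP wh ug) _; have := ccvg_conj (cdotP ug wh).
by congr ccvg; apply/funext => n; rewrite -ipC.
Qed.

Lemma cdot_ge0 g : 0 <= cdot g g.
Proof.
have gr : (cdot g g)^*%C = cdot g g by rewrite -cdotC.
have [u ug] := completion_repr g; rewrite lecE /=.
have := ccvg_Re_le (ccvgZD (-1) (cdotP ug ug) (ccvg_cst 0)) (B := 0).
rewrite addr0 mulN1r; move: gr; case: (cdot g g) => p q [/eqP].
rewrite eq_sym -subr_eq0 opprK -mulr2n mulrn_eq0 /= => /eqP -> h; rewrite eqxx /=.
rewrite -oppr_le0; apply: h; exists 0%N => n _.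
have := qge0 f (u n); case: (f (u n) (u n)) => r s /= r0; lra.
Qed.

(** The norms of a representing sequence tend to 0, so by Cauchy-Schwarz the functional vanishes at
    every [y]. *)
Lemma cdot_eq0 g : cdot g g = 0 -> g = 0.
Proof.
move=> g0; have [u ug] := completion_repr g.
apply: val_inj; apply/funext => y; rewrite [RHS]/(0 : R[i]).
apply: ccvg_unique (ug.2 y) _ => e e0.
have y0 : 0 < nrm y + 1 by rewrite ltr_wpDl ?ipnorm_ge0.
have := cdotP ug ug; rewrite g0 => /(_ ((e / (nrm y + 1)) ^+ 2)).
move=> /(_ ltac:(by rewrite exprn_gt0// divr_gt0))[N uN]; exists N => n /uN.
rewrite !subr0 => h; apply: le_lt_trans (Defs.CauchySchwarz _ _ _) _.
apply: (@mul_lt_div _ _ _ (nrm y + 1)); rewrite ?ipnorm_ge0 ?lerDl//.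
have ey : 0 <= e / (nrm y + 1) by rewrite ltW// divr_gt0.
rewrite -(@ltr_pXn2r _ 2) ?nnegrE ?ipnorm_ge0// sqr_ipnorm.
by apply: le_lt_trans h; apply: le_trans (normc_Re _); exact: ler_norm.
Qed.

Definition completion_dot : {dot completion for @Num.conj R[i]} :=
  sval (dot_of cdotPl cdotC cdot_ge0 cdot_eq0).

Lemma completion_dotP g h u w : represents u g -> represents w h ->
  ccvg (fun n => f (u n) (w n)) (completion_dot g h).
Proof.
move=> ug wh; rewrite /completion_dot; case: dot_of => d /= ->.
exact: cdotP.
Qed.

Lemma represents_norm_le g u (B : R) : represents u g ->
  (exists N, forall n, (N <= n)%N -> nrm (u n) <= B) ->
  ipnorm completion_dot g <= B.
Proof.
move=> ug [N uB].
have B0 : 0 <= B by apply: le_trans (uB _ (leqnn N)); exact: ipnorm_ge0.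
rewrite -(@ler_pXn2r _ 2) ?nnegrE ?ipnorm_ge0// sqr_ipnorm.
apply: (ccvg_Re_le (completion_dotP ug ug)); exists N => n /uB unB.
by rewrite -sqr_ipnorm ler_pXn2r ?nnegrE ?ipnorm_ge0.
Qed.

Lemma in_completion_cst x a : pl_lvl a x -> in_completion a (f x).
Proof. by move=> ax; exists (fun=> x); split=> //; exact: represents_cst. Qed.

Lemma embed_in x : (f x : pl_lmod E -> R[i]) \in completion_pred.
Proof.
by have [a ax] := pl_cover x; apply/asboolP; exists a; exact: in_completion_cst.
Qed.

Definition embed x : completion := Completion (embed_in x).

Lemma embedZD (c : R[i]) x y : embed (c *: x + y) = c *: embed x + embed y.
Proof. by apply: val_inj; apply/funext => z /=; rewrite linearPl. Qed.

Lemma embed_dot x y : completion_dot (embed x) (embed y) = f x y.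
Proof.
apply: (ccvg_unique _ (ccvg_cst (f x y))).
exact: (@completion_dotP (embed x) (embed y) (fun=> x) (fun=> y)
  (represents_cst x) (represents_cst y)).
Qed.

(** A late term of a representing sequence is close to [g], and it lies in the level [a] because the
    whole sequence does. *)
Lemma embed_approx a (g : completion) : in_completion a g ->
  forall e, 0 < e -> exists x, pl_lvl a x /\ ipnorm completion_dot (g - embed x) <= e.
Proof.
move=> [u [ua ug]] e e0; have [N uN] := ug.1 e e0.
exists (u N); split=> //; have h := representsB ug (represents_cst (u N)).
apply: (@represents_norm_le (g - embed (u N)) _ _ h); exists N => n Nn.
by rewrite ltW// uN.
Qed.

(** Diagonal argument: [x k] in the dense subspace is chosen within [1/(k+1)] of [G k]. The sequence
    [x] is then itself Cauchy, stays in the level [a], and represents the limit of [G]. *)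
Lemma completion_complete a :
  ip_complete completion_dot [set g : completion | in_completion a g].
Proof.
move=> G Ga Gc.
have pos k : 0 < k.+1%:R^-1 :> R by rewrite invr_gt0.
have /choice[x xP] k := embed_approx (Ga k) (pos k).
have embedB y z : embed (y - z) = embed y - embed z.
  by rewrite addrC -scaleN1r embedZD scaleN1r addrC.
have nrmE y : ipnorm completion_dot (embed y) = nrm y by rewrite /ipnorm embed_dot.
have xc : ip_cauchy f x.
  move=> e e0; have e3 : 0 < e / 4 by rewrite divr_gt0.
  have [N GN] := Gc _ e3; have [M MN] := invS_small e3.
  exists (maxn N M) => m n; rewrite !geq_max => /andP[Nm Mm] /andP[Nn Mn].
  rewrite -nrmE embedB.
  have -> : embed (x m) - embed (x n) =
      (embed (x m) - G m) + (G m - G n + (G n - embed (x n))) by rewrite !subrKA.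
  have := le_trans (xP m).2 (MN _ Mm); have := le_trans (xP n).2 (MN _ Mn).
  have := GN _ _ Nm Nn.
  have := ipnormD completion_dot (G m - G n) (G n - embed (x n)).
  have := ipnormD completion_dot (embed (x m) - G m) (G m - G n + (G n - embed (x n))).
  by rewrite (ipnormB _ (embed (x m)) (G m)); lra.
have /choice[g gP] y : exists l, ccvg (fun n => f (x n) y) l.
  by apply: ccvg_ip_ex => //; exact: ip_cauchy_cst.
have ga : in_completion a g.
  by exists x; split=> [n|]; [case: (xP n)|split].
have gin : g \in completion_pred by apply/asboolP; exists a.
exists (Completion gin) => //= e e0.
have e3 : 0 < e / 4 by rewrite divr_gt0.
have [N xN] := xc _ e3; have [M MN] := invS_small e3.
exists (maxn N M) => n; rewrite !geq_max => /andP[Nn Mn].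
have h : ipnorm completion_dot (embed (x n) - Completion gin) <= e / 4.
  have h := representsB (represents_cst (x n)) (conj xc gP).
  apply: (@represents_norm_le (embed (x n) - Completion gin) _ _ h).
  by exists N => k Nk; rewrite ltW// xN.
rewrite -(subrKA (embed (x n))).
have := le_trans (xP n).2 (MN _ Mn).
have := ipnormD completion_dot (G n - embed (x n)) (embed (x n) - Completion gin).
lra.
Qed.

Definition completion_locHilbert : locHilbert R D :=
  @LocHilbert R D completion completion_dot
    (fun a => [set g : completion | in_completion a g])
    (fun a => conj (in_completion0 a) (fun c g h => @in_completionZD a c g h))
    completion_complete
    (fun a b ab g => @in_completion_mono a b g ab) completion_ex.

End Completion.

(** The interface used from here on: a linear isometry that respects levels and has dense range in
    each level separately. *)
Lemma locHilbert_completion (R : realType) (D : dirset) (E : preLocHilbert R D) :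
  exists (G : locHilbert R D) (v : pl_lmod E -> G),
  [/\ forall (c : R[i]) x y, v (c *: x + y) = c *: v x + v y,
      forall x y, ip (v x) (v y) = pl_dot E x y,
      forall a x, pl_lvl a x -> lvl a (v x) &
      forall a (g : G) (e : R), lvl a g -> 0 < e ->
        exists x, pl_lvl a x /\ hnorm (g - v x) <= e].
Proof.
exists (completion_locHilbert E), (@embed R D E); split.
- exact: embedZD.
- exact: embed_dot.
- by move=> a x ax; exact: in_completion_cst.
- by move=> a g e ga e0; exact: embed_approx.
Qed.

(** * Kolmogorov decomposition of an operator-valued kernel *)

Section LocOpLinear.
Variables (R : realType) (D : dirset) (H K : locHilbert R D).

Lemma locop_linear (T : locop H K) : linear T.
Proof. by case: (locopP T). Qed.

HB.instance Definition _ (T : locop H K) :=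
  GRing.isLinear.Build R[i] H K *:%R (locop_fun T) (locop_linear T).

Lemma locop_lvl (T : locop H K) a x : lvl a x -> lvl a (T x).
Proof. by move=> ax; case: (locopP T) => _ h _ _; exact: h. Qed.

Lemma ip_suml (I : Type) (r : seq I) (F : I -> H) z :
  ip (\sum_(i <- r) F i) z = \sum_(i <- r) ip (F i) z.
Proof. by apply: (big_morph (fun x => ip x z)) => [x y|]; rewrite ?ipDl ?ip0l. Qed.

Lemma ip_sumr (I : Type) (r : seq I) (F : I -> H) z :
  ip z (\sum_(i <- r) F i) = \sum_(i <- r) ip z (F i).
Proof. by apply: (big_morph (ip z)) => [x y|]; rewrite ?ipDr ?ip0r. Qed.

Lemma lvl_sum a (I : eqType) (r : seq I) (F : I -> H) :
  (forall i, i \in r -> lvl a (F i)) -> lvl a (\sum_(i <- r) F i).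
Proof.
move=> Fa; rewrite big_seq; apply: (big_ind (lvl a)) => //; first exact: lvl0.
by move=> x y ax ay; rewrite -[x]scale1r; exact: lvlZD.
Qed.

Lemma ip0_approx (z w : H) :
  (forall e : R, 0 < e -> exists z', hnorm (z - z') <= e /\ ip z' w = 0) ->
  ip z w = 0.
Proof.
move=> zw; apply: ComplexField.Normc.eq0_normc; apply/eqP.
rewrite eq_le normc_ge0 andbT; apply/ler_addgt0Pr => e e0; rewrite add0r.
have w0 : 0 < hnorm w + 1 by rewrite ltr_wpDl ?hnorm_ge0.
have [z' [zz' z'w]] := zw (e / (hnorm w + 1)) ltac:(by rewrite divr_gt0).
have -> : ip z w = ip (z - z') w by rewrite ipBl z'w subr0.
apply: le_trans (Defs.CauchySchwarz _ _ _) _; move: zz'.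
rewrite ler_pdivlMr// => h; apply: le_trans h.
by rewrite ler_wpM2l ?hnorm_ge0// lerDl.
Qed.

End LocOpLinear.

(* Formal combinations of the [V y h] are lists of pairs (y, h): the scalars are
   absorbed in h. *)
Section Generates.
Variables (R : realType) (D : dirset) (H K : locHilbert R D) (Y : choiceType).
Implicit Types (V : Y -> locop H K) (s t : seq (Y * H)).

Definition vsum V s : K := \sum_(p <- s) V p.1 p.2.

Definition vscale (c : R[i]) s : seq (Y * H) := [seq (p.1, c *: p.2) | p <- s].

Definition seq_lvl a s := forall p, p \in s -> lvl a p.2.

(** Density is required level by level, with approximants built from vectors of the same level:
    bounds known on each level then pass from the generators to all of [K]. *)
Definition generates V := forall a g (e : R), lvl a g -> 0 < e ->
  exists s, seq_lvl a s /\ hnorm (g - vsum V s) <= e.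

Lemma vsumZD V c s t : vsum V (vscale c s ++ t) = c *: vsum V s + vsum V t.
Proof.
rewrite /vsum big_cat big_map scaler_sumr; congr (_ + _).
by apply: eq_bigr => p _; rewrite linearZ.
Qed.

Lemma seq_lvlZD a c s t : seq_lvl a s -> seq_lvl a t -> seq_lvl a (vscale c s ++ t).
Proof.
move=> sa ta p; rewrite mem_cat => /orP[/mapP[q qs ->]|/ta//].
exact: lvlZ (sa _ qs).
Qed.

Lemma seq_lvl_ex s : exists a, seq_lvl a s.
Proof.
elim: s => [|p s [a sa]]; first by have [a] := dir_inh D; exists a.
have [b bp] := lh_cover p.2; have [c [ac bc]] := dir_ub a b; exists c => q.
rewrite inE => /orP[/eqP->|/sa qa]; first exact: lh_mono bc _ bp.
exact: lh_mono ac _ qa.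
Qed.

Lemma seq_lvl_mono a b s : dir_le a b -> seq_lvl a s -> seq_lvl b s.
Proof. by move=> ab sa p /sa; exact: lh_mono ab _. Qed.

Lemma vsum_lvl V a s : seq_lvl a s -> lvl a (vsum V s).
Proof. by move=> sa; apply: lvl_sum => p /sa; exact: locop_lvl. Qed.

End Generates.

Record pd_kernel (R : realType) (D : dirset) (H : locHilbert R D)
    (Y : choiceType) := PdKernel {
  pk_fun :> Y -> Y -> locop H H;
  pk_herm : forall y z, adj (pk_fun z y) = pk_fun y z;
  pk_ge0 : forall s : seq (Y * H),
    0 <= \sum_(q <- s) ip (vsum (pk_fun q.1) s) q.2
}.

Section KernelSpace.
Variables (R : realType) (D : dirset) (H : locHilbert R D) (Y : choiceType).
Variable k : pd_kernel H Y.
Implicit Types (s t : seq (Y * H)).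

Definition ksum s (z : Y) : H := vsum (k z) s.

Definition kspan_pred : {pred Y -> H} := [pred g | `[< exists s, g = ksum s >]].

Record kspan := Kspan {kspan_fun :> Y -> H; kspan_in : kspan_fun \in kspan_pred}.

HB.instance Definition _ := [isSub for kspan_fun].
HB.instance Definition _ := [Choice of kspan by <:].

Lemma ksumZD c s t : ksum (vscale c s ++ t) = c *: ksum s + ksum t.
Proof. by apply/funext => z; rewrite /ksum vsumZD. Qed.

Lemma ksum_nil : ksum [::] = 0.
Proof. by apply/funext => z; rewrite /ksum /vsum big_nil. Qed.

Lemma kspan_submod_closed : submod_closed kspan_pred.
Proof.
split=> [|c g h]; first by apply/asboolP; exists [::]; rewrite ksum_nil.
move=> /asboolP[s ->] /asboolP[t ->]; apply/asboolP.
by exists (vscale c s ++ t); rewrite ksumZD.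
Qed.

HB.instance Definition _ := GRing.isSubmodClosed.Build R[i]
  (Y -> H) kspan_pred kspan_submod_closed.
HB.instance Definition _ := [SubChoice_isSubLmodule of kspan by <:].

Implicit Types (g h : kspan).

Lemma ksum_in s : ksum s \in kspan_pred.
Proof. by apply/asboolP; exists s. Qed.

Definition kvec s : kspan := Kspan (ksum_in s).

Lemma kvecZD c s t : kvec (vscale c s ++ t) = c *: kvec s + kvec t.
Proof. by apply: val_inj; rewrite /= ksumZD. Qed.

Lemma kspanP g : exists s, g = kvec s.
Proof.
by have /asboolP[s gs] := kspan_in g; exists s; exact: val_inj.
Qed.

Definition kform g h : R[i] :=
  \sum_(q <- xget [::] [set t | h = kvec t]) ip (g q.1) q.2.

Lemma kform_sym s t : \sum_(q <- t) ip (kvec s q.1) q.2 =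
  (\sum_(p <- s) ip (kvec t p.1) p.2)^*%C.
Proof.
rewrite rmorph_sum /=.
rewrite (eq_bigr (fun q => \sum_(p <- s) ip (k q.1 p.1 p.2) q.2)); last first.
  by move=> q _; rewrite ip_suml.
rewrite exchange_big /=; apply: eq_bigr => p _.
rewrite ip_suml rmorph_sum; apply: eq_bigr => q _.
by rewrite adjP pk_herm; exact: ip_conj.
Qed.

(** The sum must depend on [t] only through the function [kvec t]. By [kform_sym] it is the
    conjugate of a sum over a list for [g], into which [t] enters only through [kvec t]. *)
Lemma kformE g t : kform g (kvec t) = \sum_(q <- t) ip (g q.1) q.2.
Proof.
have [s ->] := kspanP g; rewrite /kform.
have /= := @xgetPex _ [::] [set t' | kvec t = kvec t'] (ex_intro _ t erefl).
by move: (xget _ _) => t' tt'; rewrite [LHS]kform_sym [RHS]kform_sym tt'.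
Qed.

Lemma kformPl c g g' h : kform (c *: g + g') h = c * kform g h + kform g' h.
Proof.
have [t ->] := kspanP h; rewrite !kformE mulr_sumr -big_split.
by apply: eq_bigr => q _; rewrite [LHS]ipDl ipZl.
Qed.

Lemma kformC g h : kform h g = (kform g h)^*%C.
Proof.
by have [s ->] := kspanP g; have [t ->] := kspanP h; rewrite !kformE; exact: kform_sym.
Qed.

Lemma kform_ge0 g : 0 <= kform g g.
Proof. by have [s ->] := kspanP g; rewrite kformE; exact: pk_ge0. Qed.

(* As [kform] is a semi-inner product, a vector of norm 0 lies in its kernel, so
   that [ip (g z) x = kform g (kvec [:: (z, x)])] vanishes. *)
Lemma kform_eq0 g : kform g g = 0 -> g = 0.
Proof.
move=> g0; have kg h : kform g h = 0.
  pose c := kform g h; pose m := complex.Re (kform h h).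
  have mE : kform h h = m%:C%C by rewrite RRe_real// ger0_real// kform_ge0.
  have m0 : 0 <= m by rewrite -ler0c -mE kform_ge0.
  apply/eqP; rewrite -/c; apply: contraT => c0.
  (* With this scalar [l * c = - (m + 1)], so the form takes the negative value [- 2 (m + 1) + m] at
     [l *: g + h]. *)
  pose l := - (m + 1)%:C%C / c.
  have := kform_ge0 (l *: g + h).
  rewrite kformPl (kformC _ g) (kformC _ h) !kformPl g0 (kformC g h) -/c mE.
  have -> : l * c = (- (m + 1))%:C%C by rewrite /l mulfVK// rmorphN.
  rewrite mulr0 add0r conjcK -rmorphD conjc_real.
  have -> : l * c = (- (m + 1))%:C%C by rewrite /l mulfVK// rmorphN.
  by rewrite -rmorphD ler0c; lra.
have [s gs] := kspanP g; apply: val_inj; apply/funext => z; apply: ip_ext => x.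
apply: etrans (esym (ip0r _)); apply: ip_sym0.
by have := kg (kvec [:: (z, x)]); rewrite kformE big_seq1.
Qed.

Definition kspan_dot : {dot kspan for @Num.conj R[i]} :=
  sval (dot_of kformPl kformC kform_ge0 kform_eq0).

Lemma kspan_dotE g t : kspan_dot g (kvec t) = \sum_(q <- t) ip (g q.1) q.2.
Proof. by rewrite /kspan_dot; case: dot_of => d /= ->; exact: kformE. Qed.

Definition kspan_lvl a : set kspan := [set g | exists s, seq_lvl a s /\ g = kvec s].

Lemma kspan_lvl_subspace a : is_subspace (kspan_lvl a).
Proof.
split=> [|c _ _ [s [sa ->]] [t [ta ->]]].
  by exists [::]; split=> //; apply: val_inj; rewrite /= ksum_nil.
by exists (vscale c s ++ t); rewrite kvecZD; split=> //; exact: seq_lvlZD.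
Qed.

Lemma kspan_lvl_mono a b : dir_le a b -> kspan_lvl a `<=` kspan_lvl b.
Proof. by move=> ab g [s [sa ->]]; exists s; split=> //; exact: seq_lvl_mono ab _. Qed.

Lemma kspan_lvl_cover g : exists a, kspan_lvl a g.
Proof.
have [s ->] := kspanP g; have [a sa] := seq_lvl_ex s.
by exists a, s.
Qed.

Definition kspan_preLocHilbert : preLocHilbert R D :=
  PreLocHilbert kspan_dot kspan_lvl_subspace kspan_lvl_mono kspan_lvl_cover.

Theorem kolmogorov_decomposition : exists (G : locHilbert R D) (V : Y -> locop H G),
  (forall y z, lcomp (adj (V z)) (V y) = k z y) /\ generates V.
Proof.
have [G [v [vZD vdot vlvl vapprox]]] := locHilbert_completion kspan_preLocHilbert.
pose T y (x : H) : G := v (kvec [:: (y, x)]).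
have kvec1 y c (h h' : H) : kvec [:: (y, c *: h + h')] =
    c *: kvec [:: (y, h)] + kvec [:: (y, h')].
  apply: val_inj; apply/funext => z.
  transitivity (c *: ksum [:: (y, h)] z + ksum [:: (y, h')] z); last by [].
  by rewrite /= /ksum /vsum !big_seq1 linearP.
have kvec_lvl y a (h : H) : lvl a h -> kspan_lvl a (kvec [:: (y, h)]).
  by move=> ah; exists [:: (y, h)]; split=> // p; rewrite inE => /eqP->.
have vT s y (h : H) : ip (v (kvec s)) (T y h) = \sum_(p <- s) ip (k y p.1 p.2) h.
  by rewrite vdot /= kspan_dotE big_seq1 /= ip_suml.
have Tloc y : is_locop (T y).
  split=> [c h h'|a h ah|a|a b ab h bh].
  - by rewrite /T kvec1 vZD.
  - by apply: vlvl; exact: kvec_lvl.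
  (* The constant comes from [|T y h|^2 = ip (k y y h) h]. *)
  - exists (Num.sqrt (opnorm a (k y y))) => h ah.
    have o0 : 0 <= opnorm a (k y y) by apply: seminorm_ge0; exact: seminorm_opnorm.
    rewrite -(@ler_pXn2r _ 2) ?nnegrE ?mulr_ge0 ?hnorm_ge0 ?sqrtr_ge0//.
    rewrite [leLHS]sqr_ipnorm -[lh_dot _ _ _]/(ip _ _) vT big_seq1 /=.
    rewrite exprMn sqr_sqrtr//.
    apply: le_trans (ler_norm _) _; apply: le_trans (normc_Re _) _.
    apply: le_trans (Defs.CauchySchwarz _ _ _) _; rewrite expr2 mulrA.
    by rewrite ler_wpM2r ?hnorm_ge0//; exact: opnorm_bound.
  - have [Ph hP] := oprojP a h.
    (* It remains to see that [T y h - T y (oproj a h)] is orthogonal to the level [a]. By density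
       it is tested on [v (kvec s)] with [s] in that level; the kernel keeps the entries of [s] in
       the level, where [h - oproj a h] is orthogonal to them. *)
    apply: oproj_eq; split=> [|z az]; first by apply: vlvl; exact: kvec_lvl.
    apply: ip0_approx => e e0; have [_ [[s [sa ->]] zs]] := vapprox a z e az e0.
    exists (v (kvec s)); split=> //; rewrite ipBr !vT -sumrB big_seq.
    apply: big1 => p ps; rewrite -ipBr; apply: hP.
    by apply: locop_lvl; exact: sa.
exists G, (fun y => mklocop (Tloc y)); split=> [y z|a g e ag e0].
  apply: locop_ext => h; apply: ip_ext => x.
  rewrite -[LHS]adjP /= vdot /= kspan_dotE big_seq1 /= /ksum /vsum big_seq1 /=.
  by rewrite adjP pk_herm.
have [_ [[s [sa ->]] zs]] := vapprox a g e ag e0; exists s; split=> //.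
suff -> : vsum (fun y => mklocop (Tloc y)) s = v (kvec s) by [].
have v0 : v (kvec [::]) = 0.
  have := vZD (-1) (kvec [::]) (kvec [::]); rewrite !scaleN1r !addNr => <-.
  by congr v; apply: val_inj; rewrite /= ksum_nil.
elim: s {sa zs} => [|p s IH]; first by rewrite /vsum big_nil v0.
rewrite /vsum big_cons -[X in _ + X]/(vsum (fun y => mklocop (Tloc y)) s) IH.
rewrite /= /T -[X in X + _]scale1r -vZD; congr v; apply: val_inj; apply/funext => z.
transitivity (1 *: ksum [:: (p.1, p.2)] z + ksum s z); first by [].
by rewrite /= /ksum /vsum scale1r big_seq1 big_cons.
Qed.

End KernelSpace.

(** * Extension of operators defined on generators *)

Section OrthogonalProjection.
Variables (R : realType) (D : dirset) (H K : locHilbert R D).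

Lemma hnorm_triangle (x y : H) : hnorm (x + y) <= hnorm x + hnorm y.
Proof. exact: ipnormD. Qed.

Lemma hnorm_distC (x y : H) : hnorm (x - y) = hnorm (y - x).
Proof. exact: ipnormB. Qed.

Lemma hnorm_scale (c : R[i]) (x : H) : hnorm (c *: x) = normc c * hnorm x.
Proof. exact: ipnormZ. Qed.

Lemma oproj_linear a : linear (oproj a : H -> H).
Proof.
move=> c x y; have [Px xP] := oprojP a x; have [Py yP] := oprojP a y.
apply: oproj_eq; split=> [|z az]; first exact: lvlZD.
rewrite opprD addrACA -scalerBr linearDr linearZr_LR /= xP// yP//.
by rewrite mulr0 addr0.
Qed.

Lemma hnorm_oproj a (x : H) : hnorm (oproj a x) <= hnorm x.
Proof.
have [Px xP] := oprojP a x.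
have [->|P0] := eqVneq (hnorm (oproj a x)) 0; first exact: hnorm_ge0.
have Pgt0 : 0 < hnorm (oproj a x) by rewrite lt_neqAle eq_sym P0 hnorm_ge0.
rewrite -(ler_pM2l Pgt0) -expr2 [leLHS]sqr_ipnorm -[lh_dot _ _ _]/(ip _ _).
have -> : ip (oproj a x) (oproj a x) = ip (oproj a x) x.
  by apply/esym/eqP; rewrite -subr_eq0 -ipBr; apply/eqP; exact: xP.
apply: le_trans (ler_norm _) _; apply: le_trans (normc_Re _) _.
exact: Defs.CauchySchwarz.
Qed.

(** A level containing [x] can be enlarged to one above [a], where the commutation clause of
    [is_locop] applies. *)
Lemma locop_oproj (T : locop H K) a x : oproj a (T x) = T (oproj a x).
Proof.
have [b bx] := lh_cover x; have [c [ac bc]] := dir_ub a b.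
by have [_ _ _ h] := locopP T; apply: (h _ _ ac); exact: lh_mono bc _ bx.
Qed.

End OrthogonalProjection.

Section Extension.
Variables (R : realType) (D : dirset) (H G K : locHilbert R D) (Y : choiceType).
Variable V : Y -> locop H G.
Hypothesis Vgen : generates V.
Implicit Types (s t : seq (Y * H)) (a b : D).

(** Stated for bare linear functions bounded on levels, since in [locop_extension] it serves to
    prove that a function is a [locop]. *)
Lemma generates_eq0 (f : G -> K) : linear f ->
  (forall a, exists M : R, forall g, lvl a g -> hnorm (f g) <= M * hnorm g) ->
  (forall y x, f (V y x) = 0) -> forall g, f g = 0.
Proof.
move=> flin fbd fV g.
pose F : {linear G -> K} := HB.pack f (GRing.isLinear.Build R[i] G K *:%R f flin).
have [a ag] := lh_cover g; have [M fM] := fbd a.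
apply: (@ipnorm0_eq0 _ _ (lh_dot K)); apply/eqP.
rewrite eq_le ipnorm_ge0 andbT; apply/ler_addgt0Pr => e e0; rewrite add0r.
have M0 : 0 < `|M| + 1 by rewrite ltr_wpDl.
have [s [sa gs]] := Vgen ag (divr_gt0 e0 M0).
have -> : f g = f (g - vsum V s).
  rewrite [RHS](raddfB F) [X in _ - X](_ : _ = 0) ?subr0//.
  by rewrite /vsum [LHS](raddf_sum F); apply: big1 => p _; exact: fV.
have ags : lvl a (g - vsum V s).
  by rewrite addrC -scaleN1r; apply: lvlZD => //; exact: vsum_lvl.
apply: le_trans (fM _ ags) _; move: gs; rewrite ler_pdivlMr// => h.
apply: le_trans h; rewrite mulrC ler_wpM2l ?hnorm_ge0//.
by have := ler_norm M; lra.
Qed.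

Lemma generates_ext (S T : locop G K) :
  (forall y, lcomp S (V y) = lcomp T (V y)) -> S = T.
Proof.
move=> ST; apply: locop_ext => g; apply/eqP; rewrite -subr_eq0; apply/eqP.
apply: (@generates_eq0 (fun x => S x - T x)) => [c x y|a|y x].
- by rewrite !locop_linear scalerBr opprD addrACA.
- exists (opnorm a S + opnorm a T) => x ax; apply: le_trans (ipnormD _ _ _) _.
  by rewrite ipnormN mulrDl; apply: lerD; exact: opnorm_bound.
- have := congr1 (fun U : locop H K => U x) (ST y).
  by rewrite /= => ->; rewrite subrr.
Qed.

Lemma generates_ip_ext (w w' : G) :
  (forall y x, ip (V y x) w = ip (V y x) w') -> w = w'.
Proof.
move=> ww'; apply: ip_ext => g; apply/eqP; rewrite -subr_eq0 -ipBr; apply/eqP.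
have [a ag] := lh_cover g; apply: ip0_approx => e e0.
have [s [_ gs]] := Vgen ag e0; exists (vsum V s); split=> //.
rewrite /vsum ip_suml; apply: big1 => p _.
by rewrite ipBr ww' subrr.
Qed.

Lemma vsum_comp (T : locop G K) s : vsum (fun y => lcomp T (V y)) s = T (vsum V s).
Proof. by rewrite /vsum linear_sum. Qed.

Lemma generates_opnorm_le (T : locop G K) a (M : R) : 0 <= M ->
  (forall s, seq_lvl a s -> hnorm (T (vsum V s)) <= M * hnorm (vsum V s)) ->
  opnorm a T <= M.
Proof.
move=> M0 TM; apply: opnorm_le => g ag g1; apply/ler_addgt0Pr => e e0.
have o0 : 0 <= opnorm a T by apply: seminorm_ge0; exact: seminorm_opnorm.
(* With [d] the distance from [g] to the approximant, [|T g|] is at most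
   [opnorm a T * d + M * (d + 1)], so [d * (opnorm a T + M)] has to be at most [e]. *)
have B0 : 0 < opnorm a T + M + 1 by lra.
have [s [sa]] := Vgen ag (divr_gt0 e0 B0).
set d := hnorm (g - vsum V s); rewrite ler_pdivlMr// => gs.
have d0 : 0 <= d by exact: hnorm_ge0.
have ags : lvl a (g - vsum V s).
  by rewrite addrC -scaleN1r; apply: lvlZD => //; exact: vsum_lvl.
have h1 : hnorm (T g) <= hnorm (T (g - vsum V s)) + hnorm (T (vsum V s)).
  rewrite -[X in hnorm (T X) <= _](subrK (vsum V s)) raddfD; exact: ipnormD.
have h2 : hnorm (vsum V s) <= d + 1.
  have -> : vsum V s = g - (g - vsum V s) by rewrite opprB addrC subrK.
  apply: le_trans (ipnormD _ _ _) _; rewrite ipnormN -!/(hnorm _) -/d; lra.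
have h3 := opnorm_bound T ags; have h4 := TM s sa; rewrite -/d in h3.
have h5 := ler_wpM2l M0 h2.
apply: le_trans h1 _; nra.
Qed.

Variable V' : Y -> locop H K.
Hypothesis V'bd : forall a, exists M : R, 0 <= M /\ forall s, seq_lvl a s ->
  hnorm (vsum V' s) <= M * hnorm (vsum V s).

(* The closure of the graph of [vsum V s |-> vsum V' s] on the level a. *)
Let graph a g k := forall e : R, 0 < e -> exists s,
  [/\ seq_lvl a s, hnorm (g - vsum V s) <= e & hnorm (k - vsum V' s) <= e].

Let graph_mono a b g k : dir_le a b -> graph a g k -> graph b g k.
Proof.
move=> ab gk e /gk[s [sa gs ks]]; exists s; split=> //.
exact: seq_lvl_mono ab sa.
Qed.

Let graphZD a c g k g' k' : graph a g k -> graph a g' k' ->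
  graph a (c *: g + g') (c *: k + k').
Proof.
move=> gk gk' e e0; have c0 : 0 < normc c + 1 by rewrite ltr_wpDl ?normc_ge0.
have [s [sa gs ks]] := gk (e / 2 / (normc c + 1)) ltac:(by rewrite !divr_gt0).
have [t [ta g't k't]] := gk' (e / 2) ltac:(by rewrite divr_gt0).
exists (vscale c s ++ t); split; first exact: seq_lvlZD.
  rewrite vsumZD opprD addrACA -scalerBr; apply: le_trans (ipnormD _ _ _) _.
  rewrite -!/(hnorm _) hnorm_scale [leRHS]splitr lerD//.
  move: gs; rewrite ler_pdivlMr// => h; apply: le_trans h.
  by rewrite mulrC ler_wpM2l ?hnorm_ge0// lerDl.
rewrite vsumZD opprD addrACA -scalerBr; apply: le_trans (ipnormD _ _ _) _.
rewrite -!/(hnorm _) hnorm_scale [leRHS]splitr lerD//.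
move: ks; rewrite ler_pdivlMr// => h; apply: le_trans h.
by rewrite mulrC ler_wpM2l ?hnorm_ge0// lerDl.
Qed.

Let graph_bound a : exists M : R, 0 <= M /\
  forall g k, graph a g k -> hnorm k <= M * hnorm g.
Proof.
have [M [M0 VM]] := V'bd a; exists M; split=> // g k gk.
apply/ler_addgt0Pr => e e0; have M1 : 0 < M + 1 by lra.
have [s [sa gs ks]] := gk (e / (M + 1)) (divr_gt0 e0 M1).
move: gs ks; rewrite !ler_pdivlMr// => gs ks.
have h1 := ipnormD (lh_dot K) (k - vsum V' s) (vsum V' s); rewrite subrK in h1.
have h2 := ipnormD (lh_dot G) (- (g - vsum V s)) g; rewrite addrC in h2.
rewrite ipnormN opprB addrC subrK -!/(hnorm _) in h2.
have := VM s sa; rewrite -!/(hnorm _) in h1 => h3.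
have := ler_wpM2l M0 h2; have := hnorm_ge0 (g - vsum V s); nra.
Qed.

(** In a common upper level the closed graph contains the pair [(0, k' - k)], and the bound forces
    its second entry to be 0. *)
Let graph_unique a b g k k' : graph a g k -> graph b g k' -> k = k'.
Proof.
move=> gk gk'; have [c [ac bc]] := dir_ub a b.
have := graphZD (-1) (graph_mono ac gk) (graph_mono bc gk').
rewrite !scaleN1r addNr => /[dup] h.
have [M [_ GM]] := graph_bound c => /GM; rewrite hnorm0 mulr0 => k0.
apply/esym/eqP; rewrite -subr_eq0 addrC; apply/eqP.
apply: (@ipnorm0_eq0 _ _ (lh_dot K)); apply/eqP.
by rewrite eq_le k0 ipnorm_ge0.
Qed.

(** Combinations tending to [g] have images that are Cauchy by [V'bd]; the limit exists because the
    level [a] of [K] is complete. *)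
Let graph_ex a g : lvl a g -> exists k, lvl a k /\ graph a g k.
Proof.
move=> ag; have [M [M0 VM]] := V'bd a; have M1 : 0 < M + 1 by lra.
have pos k : 0 < k.+1%:R^-1 :> R by rewrite invr_gt0.
have /choice[s sP] n := Vgen ag (pos n).
have sa n := (sP n).1; have gs n := (sP n).2.
have vB (X : locHilbert R D) (W : Y -> locop H X) m n :
    vsum W (s m) - vsum W (s n) = vsum W (vscale (-1) (s n) ++ s m).
  by rewrite vsumZD scaleN1r addrC.
have V'c : ip_cauchy (lh_dot K) (fun n => vsum V' (s n)).
  move=> e e0; have e4 : 0 < e / 4 / (M + 1) by rewrite !divr_gt0.
  have [N NN] := invS_small e4; exists N => m n Nm Nn; rewrite vB.
  have := VM _ (seq_lvlZD (c := -1) (sa n) (sa m)); rewrite -!vB => /le_lt_trans; apply.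
  have := le_trans (gs m) (NN _ Nm); have := le_trans (gs n) (NN _ Nn).
  rewrite !ler_pdivlMr// => hn hm.
  have := hnorm_triangle (vsum V (s m) - g) (g - vsum V (s n)).
  rewrite subrKA (hnorm_distC (vsum V (s m)) g) => h.
  have := ler_wpM2l M0 h.
  by have := hnorm_ge0 (g - vsum V (s m)); have := hnorm_ge0 (g - vsum V (s n)); nra.
have [k ak kP] := @lh_complete _ _ K a _ (fun n => vsum_lvl V' (sa n)) V'c.
exists k; split=> // e e0; have [N NN] := invS_small e0; have [N' kN'] := kP e e0.
exists (s (maxn N N')); split=> //.
  by apply: le_trans (gs _) _; apply: NN; exact: leq_maxl.
by rewrite /hnorm ipnormB ltW// kN'// leq_maxr.
Qed.

(** The closed graph is the graph of a linear function bounded on each level. It commutes with the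
    projections because it does so on the generators, where [V y] and [V' y] both commute with
    them. *)
Lemma locop_extension : exists T : locop G K, forall y, lcomp T (V y) = V' y.
Proof.
have /choice[T TP] g : exists k, exists a, graph a g k.
  by have [a /graph_ex[k [_ gk]]] := lh_cover g; exists k, a.
have TE a g k : graph a g k -> T g = k.
  by move=> gk; have [b gT] := TP g; exact: graph_unique gT gk.
have Tgraph a g : lvl a g -> lvl a (T g) /\ graph a g (T g).
  by move=> /graph_ex[k [ak gk]]; rewrite (TE _ _ _ gk).
have Tlin : linear T.
  move=> c x y; have [a [ax ay]] := lvl_common2 x y.
  by apply: (TE a); apply: graphZD; apply: (Tgraph _ _ _).2.
have Tbd a : exists M : R, 0 <= M /\ forall g, lvl a g -> hnorm (T g) <= M * hnorm g.
  have [M [M0 GM]] := graph_bound a; exists M; split=> // g /Tgraph[_].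
  exact: GM.
have TV y x : T (V y x) = V' y x.
  have [a ax] := lh_cover x; apply: (TE a) => e e0; exists [:: (y, x)].
  rewrite /vsum !big_seq1 !subrr !hnorm0 ltW//; split=> // p.
  by rewrite inE => /eqP->.
have Tproj a g : oproj a (T g) = T (oproj a g).
  apply/eqP; rewrite -subr_eq0; apply/eqP.
  apply: (@generates_eq0 (fun x => oproj a (T x) - T (oproj a x))) => [c x y|b|y x].
  - by rewrite oproj_linear !Tlin !oproj_linear scalerBr opprD addrACA.
  - have [M [M0 TM]] := Tbd a; have [N [N0 TN]] := Tbd b; exists (N + M) => x bx.
    apply: le_trans (ipnormD _ _ _) _; rewrite ipnormN mulrDl; apply: lerD.
      by apply: le_trans (hnorm_oproj _ _) _; exact: TN.
    apply: le_trans (TM _ (oprojP a x).1) _.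
    by rewrite ler_wpM2l// hnorm_oproj.
  - by rewrite TV !locop_oproj TV subrr.
have Tloc : is_locop T.
  split=> // [a x /Tgraph[]//|a].
  by have [M [_ TM]] := Tbd a; exists M.
by exists (mklocop Tloc) => y; apply: locop_ext => x; exact: TV.
Qed.

End Extension.

(** * Continuity and seminorms *)

Section SeminormContinuity.
Variable R : realType.

Lemma normc_pos (t : R) : 0 <= t -> normc t%:C%C = t.
Proof. by move=> t0; rewrite /= expr0n addr0 sqrtr_sqr ger0_norm. Qed.

Lemma nbhs_seminorm (U : PreUniformLmodule.type R[i]) (P : set (U -> R)) (x : U)
    (B : set U) : entourage = seminorm_entourage P ->
  nbhs x B <-> exists p (e : R), [/\ P p, 0 < e & forall y, p (x - y) < e -> B y].
Proof.
move=> entP; split=> [/nbhsP[E]|[p [e [Pp e0 pB]]]].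
  rewrite entP => -[p [e [Pp e0 pE]]] EB; exists p, e; split=> // y pxy.
  by apply/EB/xsectionP; exact: pE.
apply/nbhsP; exists [set xy | p (xy.1 - xy.2) < e].
  by rewrite entP; exists p, e; split.
by move=> y /xsectionP; exact: pB.
Qed.

Variables (U V : PreUniformLmodule.type R[i]).
Variables (P : set (U -> R)) (Q : set (V -> R)).
Hypotheses (entP : entourage = seminorm_entourage P)
  (entQ : entourage = seminorm_entourage Q).

Lemma seminorm_bounded_continuous (f : {linear U -> V}) :
  (forall p, P p -> forall x, 0 <= p x) ->
  (forall q, Q q -> exists p (C : R), P p /\ forall x, q (f x) <= C * p x) ->
  continuous f.
Proof.
move=> P0 fb x B /(nbhs_seminorm _ _ entQ)[q [e [Qq e0 qB]]].
have [p [C [Pp pf]]] := fb q Qq; have C0 : 0 < `|C| + 1 by rewrite ltr_wpDl.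
apply/(nbhs_seminorm _ _ entP); exists p, (e / (`|C| + 1)); split=> //.
  by rewrite divr_gt0.
move=> y; rewrite ltr_pdivlMr// => pxy; apply: qB; rewrite -raddfB.
apply: le_lt_trans (pf _) _; apply: le_lt_trans pxy; rewrite mulrC.
apply: ler_wpM2l; first exact: P0.
by have := ler_norm C; lra.
Qed.

Lemma continuous_seminorm_bounded (f : {linear U -> V}) (q : V -> R) :
  (forall p, P p -> seminorm p) -> continuous f -> Q q -> seminorm q ->
  exists p (C : R), [/\ P p, 0 <= C & forall x, q (f x) <= C * p x].
Proof.
move=> Psn fc Qq qsn.
have : nbhs (f 0) [set z | q (f 0 - z) < 1].
  by apply/(nbhs_seminorm _ _ entQ); exists q, 1; split.
move=> /fc/(nbhs_seminorm _ _ entP)[p [e [Pp e0 pe]]].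
have fe x : p x < e -> q (f x) < 1.
  have := pe x; rewrite /= sub0r raddf0 sub0r (seminormN _ qsn).
  by rewrite (seminormN _ (Psn p Pp)).
exists p, e^-1; split=> // [|x]; first by rewrite invr_ge0 ltW.
have p0 : 0 <= p x by exact: seminorm_ge0 (Psn p Pp).
(* The vector [x] is rescaled into the ball of radius [e]; dividing by [p x + d] rather than [p x]
   covers the case [p x = 0], and [d] is arbitrary. *)
rewrite mulrC ler_pdivlMr//; apply/ler_addgt0Pr => d d0.
have pd : 0 < p x + d by rewrite ltr_wpDl.
have ed : 0 < e / (p x + d) by rewrite divr_gt0.
have := fe ((e / (p x + d))%:C%C *: x).
rewrite linearZ qsn.2 (Psn p Pp).2 normc_pos ?(ltW ed)//.
rewrite mulrAC ltr_pdivrMr// ltr_pM2l// ltrDl => /(_ d0).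
by rewrite mulrAC ltr_pdivrMr// mul1r mulrC => /ltW.
Qed.

End SeminormContinuity.

Section LocHilbertContinuity.
Variables (R : realType) (D : dirset) (H K : locHilbert R D).

(** Composing a seminorm of the inductive limit topology with [T] gives another one, as [T] is
    bounded on each level. *)
Lemma locop_continuous (T : locop H K) : continuous T.
Proof.
apply: (@seminorm_bounded_continuous R H K (@indlim_seminorms R D H)
  (@indlim_seminorms R D K) erefl erefl) => [p [psn _] x|q [qsn qb]].
  exact: seminorm_ge0.
exists (q \o T), 1; split=> [|x]; last by rewrite mul1r.
split=> [|a].
  split=> [x y|c x] /=; first by rewrite raddfD; exact: qsn.1.
  by rewrite linearZ qsn.2.
have [M qM] := qb a; exists (`|M| * opnorm a T) => x ax /=.
apply: le_trans (qM _ (locop_lvl T ax)) _; rewrite -mulrA.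
apply: le_trans (_ : `|M| * hnorm (T x) <= _).
  by apply: ler_wpM2r; [exact: hnorm_ge0|exact: ler_norm].
by apply: ler_wpM2l => //; exact: opnorm_bound.
Qed.

(** Approximation in the norm of one level is approximation for every seminorm of the inductive
    limit topology, since each is dominated by a multiple of that norm there. *)
Lemma closed_span_generates (Y : choiceType) (V : Y -> locop H K) (Z : set K) :
  generates V -> (forall y x, Z (V y x)) -> closed_span Z = [set: K].
Proof.
move=> Vgen VZ; apply/seteqP; split=> // g _ E [[[E0 EZ] Ecl] ZE].
apply: Ecl => B /(@nbhs_seminorm R K (@indlim_seminorms R D K) _ _ erefl).
move=> [q [e [[qsn qb] e0 qB]]].
have [a ag] := lh_cover g; have [M qM] := qb a.
have M0 : 0 < `|M| + 1 by rewrite ltr_wpDl.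
have [s [sa gs]] := Vgen a g (e / 2 / (`|M| + 1)) ag ltac:(by rewrite !divr_gt0).
exists (vsum V s); split.
  rewrite /vsum; apply: (big_ind E) => // [x y Ex Ey|p _].
    by rewrite -[x]scale1r; exact: EZ.
  by apply: ZE; exact: VZ.
apply: qB; have ags : lvl a (g - vsum V s).
  by rewrite addrC -scaleN1r; apply: lvlZD => //; exact: vsum_lvl.
apply: le_lt_trans (qM _ ags) _; move: gs; rewrite ler_pdivlMr//.
have := hnorm_ge0 (g - vsum V s); have := ler_norm M.
move: (hnorm _) => t h1 h2; nra.
Qed.

End LocHilbertContinuity.

Section CstarSeminorms.
Variable R : realType.

Lemma seminorm_continuous (A : locCstarType R) (P : set (A -> R)) (p : A -> R) :
  entourage = seminorm_entourage P -> P p -> seminorm p -> continuous p.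
Proof.
move=> entP Pp psn x; apply/cvgrPdist_lt => e e0.
apply/(@nbhs_seminorm R A P _ _ entP); exists p, e; split=> // y.
apply: le_lt_trans; rewrite ler_norml; apply/andP; split.
  have := psn.1 (y - x) x; rewrite subrK -opprB (seminormN _ psn); lra.
by have := psn.1 (x - y) y; rewrite subrK; lra.
Qed.

(** If [t < r], the powers of [t / r] tend to 0, which contradicts [1 <= K * (t / r) ^+ (2 ^ k)] for
    large [k]. *)
Lemma exp_bound_le (r t K : R) : 0 <= r -> 0 <= t ->
  (forall k, r ^+ (2 ^ k) <= K * t ^+ (2 ^ k)) -> r <= t.
Proof.
move=> r0 t0 rt; rewrite leNgt; apply/negP => tr.
have rgt0 : 0 < r by exact: le_lt_trans tr.
have q0 : 0 <= t / r by rewrite divr_ge0.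
have q1 : t / r < 1 by rewrite ltr_pdivrMr// mul1r.
have K0 : 0 < `|K| + 1 by rewrite ltr_wpDl.
have /cvgrPdist_lt : (fun n => (t / r) ^+ n) @ \oo --> (0 : R).
  by apply: cvg_expr; rewrite ger0_norm.
move=> /(_ (`|K| + 1)^-1 ltac:(by rewrite invr_gt0))[N _ NN].
(* The exponent [2 ^ N] is admissible since it exceeds [N]. *)
have := NN (2 ^ N)%N (ltnW (ltn_expl N (ltnSn 1))).
rewrite /= sub0r normrN ger0_norm ?exprn_ge0// expr_div_n.
rewrite ltr_pdivrMr ?exprn_gt0// mulrC ltr_pdivlMr//.
have := rt N; have := ler_norm K; have : 0 <= t ^+ (2 ^ N) by rewrite exprn_ge0.
nra.
Qed.

(* The Schwarz inequality [N c ^ 2 <= N (c^* c) N 1] is iterated along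
   [c, c^* c, (c^* c)^2, ...]: the crude constant K enters only through its
   [2^k]-th roots, which tend to 1. *)
Lemma Cstar_seminorm_le (A : starAlgType R[i]) (p N : A -> R) (K : R) :
  Cstar_seminorm p -> (forall c, 0 <= N c) ->
  (forall c, N c ^+ 2 <= N (star c * c) * N 1) -> (forall c, N c <= K * p c) ->
  forall a, N a <= p a * N 1.
Proof.
move=> [psn pM ps pC] N0 NS NK a.
have p0 c : 0 <= p c by exact: seminorm_ge0.
have [N1|N1] := eqVneq (N 1) 0.
  have := NS a; rewrite N1 !mulr0 => h.
  have : N a ^+ 2 == 0 by rewrite eq_le h sqr_ge0.
  by rewrite sqrf_eq0 => /eqP->.
have Ngt0 : 0 < N 1 by rewrite lt_neqAle eq_sym N1 N0.
pose c k := iter k (fun c => star c * c) a.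
have pc k : p (c k) = p a ^+ (2 ^ k).
  by elim: k => [|k IH]; rewrite ?expr1// expnS mulnC exprM -IH /= pC.
have Nc k : (N a / N 1) ^+ (2 ^ k) <= N (c k) / N 1.
  elim: k => [|k IH]; first by rewrite expr1.
  rewrite expnS mulnC exprM; apply: le_trans (_ : (N (c k) / N 1) ^+ 2 <= _).
    by rewrite ler_pXn2r ?nnegrE// ?exprn_ge0 ?divr_ge0.
  rewrite expr_div_n ler_pdivrMr ?exprn_gt0// expr2 mulrA mulfVK//.
  exact: NS.
rewrite -ler_pdivrMr//; apply: (@exp_bound_le _ _ (K / N 1)).
- by rewrite divr_ge0.
- exact: p0.
- move=> k; apply: le_trans (Nc k) _; rewrite mulrAC ler_pdivrMr// mulfVK//.
  by rewrite -pc.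
Qed.

End CstarSeminorms.

(** * Gram kernels *)

Section AdjointForms.
Variables (R : realType) (D : dirset) (H : locHilbert R D).

Lemma ip_adjl (G K : locHilbert R D) (T : locop G K) x y :
  ip (adj T x) y = ip x (T y).
Proof. by rewrite ip_conj -adjP; exact: esym (ip_conj _ _). Qed.

Lemma adj_adj (G K : locHilbert R D) (T : locop G K) : adj (adj T) = T.
Proof. by apply: adj_unique => x y; exact: ip_adjl. Qed.

Variable Y : choiceType.

Lemma vsum_ip (G : locHilbert R D) (V W : Y -> locop H G) s t :
  ip (vsum V s) (vsum W t) =
  \sum_(q <- t) \sum_(p <- s) ip (lcomp (adj (W q.1)) (V p.1) p.2) q.2.
Proof.
rewrite /vsum ip_sumr; apply: eq_bigr => q _; rewrite ip_suml.
by apply: eq_bigr => p _; rewrite /= ip_adjl.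
Qed.

Lemma vsum_ip_eq (G G' : locHilbert R D) (V W : Y -> locop H G)
    (V' W' : Y -> locop H G') s t :
  (forall y z, lcomp (adj (W z)) (V y) = lcomp (adj (W' z)) (V' y)) ->
  ip (vsum V s) (vsum W t) = ip (vsum V' s) (vsum W' t).
Proof.
move=> VW; rewrite !vsum_ip; apply: eq_bigr => q _; apply: eq_bigr => p _.
by rewrite VW.
Qed.

Lemma lcomp_suml (G : locHilbert R D) (I : Type) (r : seq I)
    (F : I -> locop H G) x : (\sum_(i <- r) F i) x = \sum_(i <- r) F i x.
Proof. exact: (big_morph (fun T : locop H G => T x)). Qed.

Variable k : Y -> Y -> locop H H.

(** Every finite matrix of values of the kernel factors as [Z^* Z] with [Z] a rectangular operator
    matrix; [T] indexes its rows, and [G] and [Z] may vary with the chosen points. *)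
Definition gram := forall m (y : 'I_m -> Y),
  exists (T : finType) (G : locHilbert R D) (Z : T -> 'I_m -> locop H G),
  forall i j, k (y i) (y j) = \sum_t lcomp (adj (Z t i)) (Z t j).

Hypothesis kgram : gram.

Lemma gram_herm y z : adj (k z y) = k y z.
Proof.
have [T [G [Z kE]]] := kgram (fun i : 'I_2 => if i == 0 then y else z).
have := kE 0 1; have := kE 1 0; rewrite /= => -> ->.
apply: adj_unique => u v; rewrite !lcomp_suml ip_suml ip_sumr.
by apply: eq_bigr => t _; rewrite /= ip_adjl adjP.
Qed.

(** The double sum regroups, row by row of [Z], into a sum of squared norms. *)
Lemma gram_ge0 (s : seq (Y * H)) : 0 <= \sum_(q <- s) ip (vsum (k q.1) s) q.2.
Proof.
have [T [G [Z kE]]] := kgram (fun i => (tnth (in_tuple s) i).1).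
pose h i := (tnth (in_tuple s) i).2.
suff -> : \sum_(q <- s) ip (vsum (k q.1) s) q.2 =
    \sum_t ip (\sum_i Z t i (h i)) (\sum_i Z t i (h i)).
  by apply: sumr_ge0 => t _; exact: ip_ge0.
rewrite [LHS]big_tnth; under [RHS]eq_bigr do rewrite ip_sumr.
rewrite exchange_big /=; apply: eq_bigr => i _.
rewrite /vsum ip_suml [LHS]big_tnth; under [RHS]eq_bigr do rewrite ip_suml.
rewrite exchange_big /=; apply: eq_bigr => j _.
rewrite kE lcomp_suml ip_suml; apply: eq_bigr => t _.
by rewrite /= ip_adjl.
Qed.

Definition gram_kernel := PdKernel gram_herm gram_ge0.

End AdjointForms.

Section CompletelyPositiveKernel.

Lemma mxstar_mulE (A : starRingType) m (X Y : 'M[A]_m) i j :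
  (star X * Y) i j = \sum_t star (X t i) * Y t j.
Proof. by rewrite mxE; apply: eq_bigr => t _; rewrite mxE. Qed.

Variables (R : realType) (A : locCstarType R).
Variables (H : locHilbert R (Sdir A)) (n : nat).
Variable phi : 'I_n -> 'I_n -> {linear A -> locop H H}.

Definition cnp_kernel (z y : A * 'I_n) := phi z.2 y.2 (star z.1 * y.1).

Hypothesis phi_cnp : completely_n_positive (fun i j => phi i j : A -> locop H H).

(** For points [(b_l, i_l)] one builds a block matrix [X] whose block [(k, l)] of [X^* X] has entry
    [b_k^* b_l] at [(i_k, i_l)]. Complete n-positivity factors its image as [Z^* Z], and the needed
    columns of [Z] give the Gram factorization. *)
Lemma cnp_gram : gram cnp_kernel.
Proof.
case=> [|m] y; first by exists void, H, (fun _ _ => 0) => -[].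
(* Only the first block row is nonzero, and in it only the row [(y 0).2] of each block. Any fixed
   row would do; the first point supplies one, so the empty family was treated apart. *)
pose X : 'M['M[A]_n]_m.+1 := \matrix_(t, l)
  if t == 0 then \matrix_(i, j)
    if (i == (y 0).2) && (j == (y l).2) then (y l).1 else 0
  else 0.
have [Z ZE] := phi_cnp X.
exists ('I_m.+1 * 'I_n)%type, H, (fun t l => Z t.1 l t.2 (y l).2) => k l.
have := congr1 (fun B : 'M['M[locop H H]_n]_m.+1 => B k l (y k).2 (y l).2) ZE.
rewrite [in LHS]mxE [LHS]mxE !mxstar_mulE !summxE.
under [RHS]eq_bigr do rewrite mxstar_mulE.
rewrite pair_big /= => <-; rewrite /cnp_kernel; congr (phi _ _ _).
rewrite (bigD1 ord0)//= big1 ?addr0 => [|t t0]; last first.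
  rewrite mxstar_mulE; apply: big1 => r _.
  by rewrite /X !mxE (negbTE t0) !mxE mulr0.
rewrite mxstar_mulE (bigD1 (y 0).2)//= big1 ?addr0 => [|r r0]; last first.
  by rewrite /X !mxE (negbTE r0) mulr0.
by rewrite /X !mxE !eqxx.
Qed.

End CompletelyPositiveKernel.

(** * The representation of the algebra *)

Lemma star1 (A : starRingType) : star (1 : A) = 1.
Proof. by rewrite -[LHS]mulr1 -[X in _ * X]starK -starM mulr1 starK. Qed.

Lemma mip_ract (R : realType) (A : locCstarType R) (M : hilbModType A)
    (x y : M) (a b : A) :
  mip (ract x a) (ract y b) = star a * mip x y * b.
Proof. by rewrite mipMr (mipC y) mipMr starM -mipC. Qed.

Section Decomposition.
Variables (R : realType) (D : dirset) (H G : locHilbert R D) (Y : choiceType).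
Variables (k : Y -> Y -> locop H H) (V : Y -> locop H G).
Hypotheses (Vk : forall y z, lcomp (adj (V z)) (V y) = k z y) (Vgen : generates V).

Lemma ip_decomp y z h h' : ip (V y h) (V z h') = ip (k z y h) h'.
Proof. by rewrite -Vk /= ip_adjl. Qed.

(** Vectors of [G] are determined by their inner products with the [V z h'], and for [V y h] these
    are values of the kernel. *)
Lemma decomp_linear (c : R[i]) y y1 y2 :
  (forall z, k z y = c *: k z y1 + k z y2) -> V y = c *: V y1 + V y2.
Proof.
move=> ky; apply: locop_ext => h; apply: (generates_ip_ext Vgen) => z h'.
rewrite ip_conj ip_decomp ky [RHS]ip_conj; congr (_^*)%C.
transitivity (ip (c *: k z y1 h + k z y2 h) h'); first by [].
transitivity (ip (c *: V y1 h + V y2 h) (V z h')); last by [].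
by rewrite !ipDl !ipZl !ip_decomp.
Qed.

End Decomposition.

Section Stinespring.
Variables (R : realType) (A : locCstarType R) (H : locHilbert R (Sdir A)).
Variables (n : nat) (phi : 'I_n -> 'I_n -> {linear A -> locop H H}).
Hypothesis phi_cont : forall i j, continuous (phi i j).
Variable P : set (A -> R).
Hypotheses (Pdir : directed_family P) (Pcs : forall p, P p -> Cstar_seminorm p)
  (entP : entourage = seminorm_entourage P).

Let Psn p : P p -> seminorm p. Proof. by case/Pcs. Qed.

(** Continuity bounds each of the finitely many entries by its own seminorm of [P]; directedness
    replaces them one after the other by a common one. *)
Lemma cnp_bounded a : exists p (C : R),
  [/\ P p, 0 <= C & forall i j c, opnorm a (phi i j c) <= C * p c].
Proof.
have phib i j := continuous_seminorm_bounded entP (erefl : entourage =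
  seminorm_entourage (@opnorms R _ H H)) Psn (@phi_cont i j) (ex_intro2 _ _ a I erefl)
  (@seminorm_opnorm _ _ _ _ a).
suff [p [C [Pp C0 pC]]] : exists p (C : R), [/\ P p, 0 <= C & forall ij,
    ij \in enum {: 'I_n * 'I_n} -> forall c, opnorm a (phi ij.1 ij.2 c) <= C * p c].
  by exists p, C; split=> // i j c; apply: (pC (i, j)); rewrite mem_enum.
elim: (enum _) => [|[i j] r [p [C [Pp C0 pC]]]].
  by have [[p Pp] _] := Pdir; exists p, 0.
have [q [B [Pq B0 qB]]] := phib i j.
have [s [Ps ps qs]] := Pdir.2 _ _ Pp Pq; exists s, (C + B).
have s0 c : 0 <= s c by exact: seminorm_ge0 (Psn Ps).
split=> // [|ij]; first exact: addr_ge0.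
rewrite inE => /orP[/eqP-> c|/pC {}pC c]; rewrite mulrDl.
  apply: le_trans (qB c) _; apply: le_trans (ler_wpM2l B0 (qs c)) _.
  by rewrite lerDr mulr_ge0.
apply: le_trans (pC c) _; apply: le_trans (ler_wpM2l C0 (ps c)) _.
by rewrite lerDl mulr_ge0.
Qed.

Variables (G : locHilbert R (Sdir A)) (V : A * 'I_n -> locop H G).
Hypotheses (Vk : forall y z, lcomp (adj (V z)) (V y) = cnp_kernel phi z y)
  (Vgen : generates V).

Let shift (a : A) (y : A * 'I_n) := (a * y.1, y.2).

(** This is the bound on [pi a] before [pi] exists: [N c] below plays the role of the norm of [pi c]
    applied to [vsum V s]. The seminorm [p] depends on the level only, not on [a] or [s]. *)
Lemma shift_bounded al : exists p, P p /\ forall a s, seq_lvl al s ->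
  hnorm (vsum (V \o shift a) s) <= p a * hnorm (vsum V s).
Proof.
have [p [C [Pp C0 pC]]] := cnp_bounded al; exists p; split=> // a s sal.
have [psn pM ps pCs] := Pcs Pp.
have p0 c : 0 <= p c by exact: seminorm_ge0.
have [K NK] : exists K, forall c,
      hnorm (vsum (V \o shift c) s) <= K * p c.
  elim: s sal => [|[[b i] h] s IH] sal.
    by exists 0 => c; rewrite /vsum big_nil hnorm0 mul0r.
  have [|K NK] := IH; first by move=> q qs; apply: sal; rewrite inE qs orbT.
  have hal : lvl al h by apply: (sal ((b, i), h)); rewrite inE eqxx.
  (* A crude constant, which may depend on [s]. It comes from [|V (c b, i) h|^2 = ip (phi i i ((c
     b)^* (c b)) h) h], at most [C * p (c b) ^+ 2 * |h| ^+ 2]. *)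
  exists (Num.sqrt C * p b * hnorm h + K) => c.
  have -> : vsum (V \o shift c) ((b, i, h) :: s) =
      V (c * b, i) h + vsum (V \o shift c) s by rewrite /vsum big_cons.
  rewrite mulrDl; apply: le_trans (hnorm_triangle _ _) _.
  apply: lerD; last exact: NK.
  rewrite -(@ler_pXn2r _ 2) ?nnegrE ?mulr_ge0 ?hnorm_ge0 ?sqrtr_ge0//.
  rewrite [leLHS]sqr_ipnorm -[lh_dot _ _ _]/(ip _ _) (ip_decomp Vk).
  rewrite !exprMn sqr_sqrtr//; apply: le_trans (ler_norm _) _.
  apply: le_trans (normc_Re _) _; apply: le_trans (Defs.CauchySchwarz _ _ _) _.
  rewrite -!/(hnorm _) [leRHS](_ : _ = C * (p b * p c) ^+ 2 * hnorm h * hnorm h);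
    last by ring.
  apply: ler_wpM2r; first exact: hnorm_ge0.
  apply: le_trans (opnorm_bound _ hal) _; apply: ler_wpM2r; first exact: hnorm_ge0.
  apply: le_trans (pC _ _ _) _; apply: ler_wpM2l => //=.
  rewrite pCs ler_pXn2r ?nnegrE ?mulr_ge0// [leRHS]mulrC.
  exact: pM.
pose N c := hnorm (vsum (V \o shift c) s).
have -> : hnorm (vsum V s) = N 1.
  rewrite /N; congr (hnorm (vsum _ s)); apply/funext => -[b i].
  by rewrite /= /shift mul1r.
apply: (@Cstar_seminorm_le R A p N K) => // [|] c; first exact: hnorm_ge0.
rewrite [leLHS]sqr_ipnorm -[lh_dot _ _ _]/(ip _ _).
(* The Schwarz inequality for [N]: moving [c] across the inner product turns the pair [(c, c)] into
   [(c^* c, 1)]. *)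
rewrite (@vsum_ip_eq _ _ _ _ G G _ _ (V \o shift (star c * c)) (V \o shift 1)).
  apply: le_trans (ler_norm _) _; apply: le_trans (normc_Re _) _.
  exact: Defs.CauchySchwarz.
move=> y z; rewrite /= !Vk /cnp_kernel /shift /=; congr (phi _ _ _).
by rewrite mul1r starM !mulrA.
Qed.

(** The operator [pi a] extends [V y |-> V (shift a y)], and its algebraic properties are tested on
    generators; compatibility with [star] is [(a b)^* c = b^* (a^* c)] inside the kernel. The bounds
    by members of [P] are kept for the module. *)
Lemma stinespring : exists pi : {linear A -> locop G G},
  [/\ continuous_star_rep pi,
      forall a y, lcomp (pi a) (V y) = V (a * y.1, y.2) &
      forall al, exists p, P p /\ forall a, opnorm al (pi a) <= p a].
Proof.
have /choice[pi piV] a : exists T : locop G G, forall y, lcomp T (V y) = V (shift a y).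
  apply: (locop_extension Vgen (V' := V \o shift a)) => al.
  have [p [Pp pV]] := shift_bounded al; exists (p a); split; last exact: pV.
  exact: seminorm_ge0 (Psn Pp).
have pi_lin : linear pi.
  move=> c a b; apply: (generates_ext Vgen) => y; rewrite piV.
  transitivity (c *: V (shift a y) + V (shift b y)).
    apply: (decomp_linear Vk Vgen) => z; rewrite /cnp_kernel /shift /= -linearP.
    by rewrite mulrDl mulrDr -scalerAl -scalerAr.
  by rewrite -!piV; apply: locop_ext.
pose piL : {linear A -> locop G G} :=
  HB.pack pi (GRing.isLinear.Build R[i] A (locop G G) *:%R pi pi_lin).
have pib al : exists p, P p /\ forall a, opnorm al (pi a) <= p a.
  have [p [Pp pV]] := shift_bounded al; exists p; split=> // a.
  apply: (generates_opnorm_le Vgen); first exact: seminorm_ge0 (Psn Pp).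
  move=> s /(pV a); rewrite -vsum_comp; congr (hnorm (vsum _ s) <= _).
  by apply/funext => y; rewrite piV.
exists piL; split=> //; split=> [|a b|a].
- apply: (seminorm_bounded_continuous entP (erefl : entourage =
    seminorm_entourage (@opnorms R _ G G))) => [p Pp x|_ [al _ <-]].
    exact: seminorm_ge0 (Psn Pp).
  by have [p [Pp pip]] := pib al; exists p, 1; split=> // a; rewrite mul1r; exact: pip.
- apply: (generates_ext Vgen) => y; rewrite [LHS]piV.
  transitivity (lcomp (pi a) (lcomp (pi b) (V y))); last exact: locop_ext.
  by rewrite !piV /shift /= mulrA.
- apply/esym/(generates_ext Vgen) => y; apply: locop_ext => h.
  apply: (generates_ip_ext Vgen) => z h'.
  transitivity (ip (lcomp (pi a) (V z) h') (V y h)); first exact: esym (adjP _ _ _).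
  transitivity (ip (V z h') (lcomp (pi (star a)) (V y) h)); last by [].
  rewrite !piV !(ip_decomp Vk) /cnp_kernel /shift /=.
  by rewrite starM starK mulrA.
Qed.

End Stinespring.

(** * The representation of the module *)

Section ModuleDilation.
Variables (R : realType) (A : locCstarType R) (M : hilbModType A).
Variables (H K : locHilbert R (Sdir A)) (n : nat).
Variables (phi : 'I_n -> 'I_n -> {linear A -> locop H H})
  (Phi : 'I_n -> 'I_n -> {linear M -> locop H K}).
Hypothesis Phi_cp : cp_matrix phi Phi.

Definition module_kernel (z y : M * 'I_n) := phi z.2 y.2 (mip z.1 y.1).

Lemma module_gram : gram module_kernel.
Proof.
move=> m y; exists 'I_n, K, (fun r l => Phi r (y l).2 (y l).1) => i j.
by rewrite /module_kernel -Phi_cp.2.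
Qed.

Variables (KPhi : locHilbert R (Sdir A)) (V' : M * 'I_n -> locop H KPhi).
Hypotheses (V'k : forall y z, lcomp (adj (V' z)) (V' y) = module_kernel z y)
  (V'gen : generates V').

(** The squared norm of a combination of the [V' y] is the sum over [r] of those of the combinations
    of the [Phi r y.2 y.1], so each single [i] gives a contraction. *)
Lemma coordinate_map_ex i : exists T : locop KPhi K,
  forall y, lcomp T (V' y) = Phi i y.2 y.1.
Proof.
apply: (locop_extension V'gen (V' := fun y => Phi i y.2 y.1)) => a.
exists 1; split=> // s _; rewrite mul1r.
rewrite -(@ler_pXn2r _ 2) ?nnegrE ?hnorm_ge0// !sqr_ipnorm.
have sumE : ip (vsum V' s) (vsum V' s) =
    \sum_r ip (vsum (fun y => Phi r y.2 y.1) s) (vsum (fun y => Phi r y.2 y.1) s).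
  rewrite vsum_ip; under [RHS]eq_bigr do rewrite vsum_ip.
  rewrite [RHS]exchange_big /=; apply: eq_bigr => q _.
  rewrite [RHS]exchange_big /=; apply: eq_bigr => p _.
  rewrite -[adj _ (V' _ _)]/(lcomp (adj (V' q.1)) (V' p.1) p.2) V'k.
  by rewrite /module_kernel -Phi_cp.2 lcomp_suml ip_suml.
rewrite -[X in _ <= complex.Re X]/(ip _ _) sumE (bigD1 i)//= raddfD lerDl.
rewrite raddf_sum; apply: sumr_ge0 => r _; exact: qge0.
Qed.

Variables (HPhi : locHilbert R (Sdir A)) (V : A * 'I_n -> locop H HPhi).
Hypotheses (Vk : forall y z, lcomp (adj (V z)) (V y) = cnp_kernel phi z y)
  (Vgen : generates V).
Variable pi : {linear A -> locop HPhi HPhi}.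
Hypotheses (pi_rep : continuous_star_rep pi)
  (piV : forall a y, lcomp (pi a) (V y) = V (a * y.1, y.2))
  (pi_bd : forall al, exists p : A -> R,
    [/\ Cstar_seminorm p, continuous p & forall a, opnorm al (pi a) <= p a]).

Let mshift (x : M) (y : A * 'I_n) := (ract x y.1, y.2).

Lemma mshift_kernel x x' y z :
  module_kernel (mshift x z) (mshift x' y) = cnp_kernel phi z (mip x x' * y.1, y.2).
Proof. by rewrite /module_kernel /cnp_kernel /= mip_ract mulrA. Qed.

(** The square of the left side is the inner product of [pi (mip x x)] applied to [vsum V s] with
    [vsum V s]. As [p] belongs to [Sdir A], the resulting factor is one of the seminorms defining
    the topology of [M]. *)
Lemma mshift_bounded al : exists p : Sdir A, forall x s, seq_lvl al s ->
  hnorm (vsum (V' \o mshift x) s) <= Num.sqrt (p (mip x x)) * hnorm (vsum V s).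
Proof.
have [p [pcs pc pip]] := pi_bd al; exists (ContCstarSeminorm pcs pc) => x s sal /=.
have p0 c : 0 <= p c by have [psn _ _ _] := pcs; exact: seminorm_ge0.
rewrite -(@ler_pXn2r _ 2) ?nnegrE ?mulr_ge0 ?hnorm_ge0 ?sqrtr_ge0//.
rewrite [leLHS]sqr_ipnorm -[lh_dot _ _ _]/(ip _ _) exprMn sqr_sqrtr//.
have -> : ip (vsum (V' \o mshift x) s) (vsum (V' \o mshift x) s) =
    ip (pi (mip x x) (vsum V s)) (vsum V s).
  rewrite -vsum_comp; apply: vsum_ip_eq => y z.
  by rewrite piV Vk /= V'k mshift_kernel.
apply: le_trans (ler_norm _) _; apply: le_trans (normc_Re _) _.
apply: le_trans (Defs.CauchySchwarz _ _ _) _; rewrite expr2 mulrA.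
apply: ler_wpM2r; first exact: hnorm_ge0.
apply: le_trans (opnorm_bound _ (vsum_lvl V sal)) _.
by apply: ler_wpM2r; [exact: hnorm_ge0|exact: pip].
Qed.

(** [Pi x] extends [V y |-> V' (mshift x y)]; its relation to [pi] is [mshift_kernel] read on
    generators. *)
Lemma module_rep_ex : exists Pi : {linear M -> locop HPhi KPhi},
  associated_rep pi Pi /\ forall x y, lcomp (Pi x) (V y) = V' (ract x y.1, y.2).
Proof.
have /choice[Pi PiV] x : exists T : locop HPhi KPhi,
    forall y, lcomp T (V y) = V' (mshift x y).
  apply: (locop_extension Vgen (V' := V' \o mshift x)) => al.
  have [p pV] := mshift_bounded al; exists (Num.sqrt (p (mip x x))).
  by split=> [|s]; [exact: sqrtr_ge0|exact: pV].
have Pi_lin : linear Pi.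
  move=> c x x'; apply: (generates_ext Vgen) => y; rewrite PiV.
  transitivity (c *: V' (mshift x y) + V' (mshift x' y)).
    apply: (decomp_linear V'k V'gen) => z; rewrite /module_kernel /mshift /= -linearP.
    by rewrite ractDl ractZl mipDr mipZr.
  by rewrite -!PiV; apply: locop_ext.
pose PiL : {linear M -> locop HPhi KPhi} :=
  HB.pack Pi (GRing.isLinear.Build R[i] M (locop HPhi KPhi) *:%R Pi Pi_lin).
exists PiL; split=> //; split=> // [|x x'].
  apply: (seminorm_bounded_continuous (@hilbmod_topology R A M) (erefl : entourage =
    seminorm_entourage (@opnorms R _ HPhi KPhi))) => [_ [p _ <-] x|_ [al _ <-]].
    exact: sqrtr_ge0.
  have [p pV] := mshift_bounded al.
  exists (fun x => Num.sqrt (p (mip x x))), 1; split=> [|x]; first by exists p.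
  rewrite mul1r; apply: (generates_opnorm_le Vgen); first exact: sqrtr_ge0.
  move=> s /(pV x); rewrite -vsum_comp; congr (hnorm (vsum _ s) <= _).
  by apply/funext => y; rewrite PiV.
apply: (generates_ext Vgen) => y; apply: locop_ext => h.
apply: (generates_ip_ext Vgen) => z h'.
transitivity (ip (lcomp (Pi x) (V z) h') (lcomp (Pi x') (V y) h)).
  exact: esym (adjP _ _ _).
transitivity (ip (V z h') (lcomp (pi (mip x x')) (V y) h)); last by [].
rewrite !PiV piV (ip_decomp V'k) (ip_decomp Vk) mshift_kernel /cnp_kernel /=.
by rewrite starM -mipC mulrA.
Qed.

End ModuleDilation.

(** * Assembly of the dilation *)

Theorem theorem2p2 (R : realType) (A : locCstarType R) (M : hilbModType A)
    (H K : locHilbert R (Sdir A)) (n : nat)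
    (phi : 'I_n -> 'I_n -> {linear A -> locop H H})
    (Phi : 'I_n -> 'I_n -> {linear M -> locop H K}) :
  (0 < n)%N -> continuous_cnp phi -> cp_matrix phi Phi ->
  exists (HPhi KPhi : locHilbert R (Sdir A))
    (pi_phi : {linear A -> locop HPhi HPhi})
    (pi_Phi : {linear M -> locop HPhi KPhi})
    (S : 'I_n -> locop H HPhi) (W : 'I_n -> locop K KPhi),
    [/\ associated_rep pi_phi pi_Phi,
        (forall i, continuous (S i)) /\ (forall i, continuous (W i)),
        (forall i j a, phi i j a = lcomp (adj (S i)) (lcomp (pi_phi a) (S j))) /\
        (forall i j x, Phi i j x = lcomp (adj (W i)) (lcomp (pi_Phi x) (S j))),
        closed_span (\bigcup_(i in [set: 'I_n])
          [set pi_phi a (S i h) | a in [set: A] & h in [set: H]]) = [set: HPhi] &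
        closed_span (\bigcup_(i in [set: 'I_n])
          [set pi_Phi x (S i h) | x in [set: M] & h in [set: H]]) = [set: KPhi]].
Proof.
move=> _ [phi_cont phi_cnp] Phi_cp.
have [P [Pdir Pcs entP]] := @locCstar_topology R A.
have [HPhi [V [Vk Vgen]]] := kolmogorov_decomposition (gram_kernel (cnp_gram phi_cnp)).
have [KPhi [V' [V'k V'gen]]] :=
  kolmogorov_decomposition (gram_kernel (module_gram Phi_cp)).
have [pi [pi_rep piV pi_bd]] := stinespring phi_cont Pdir Pcs entP Vk Vgen.
have [|Pi [Pi_rep PiV]] := module_rep_ex V'k V'gen Vk Vgen pi_rep piV.
  move=> al; have [p [Pp pip]] := pi_bd al; exists p; split=> //; first exact: Pcs.
  by apply: (seminorm_continuous entP Pp); have [] := Pcs p Pp.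
have /choice[T TV'] := coordinate_map_ex Phi_cp V'k V'gen.
exists HPhi, KPhi, pi, Pi, (fun i => V (1, i)), (fun i => adj (T i)).
(* The units of the algebra and of the action show that the generators [V (a, i)] and [V' (x, i)]
   are [pi a] and [Pi x] composed with the [S i]; minimality of both spaces then follows from
   [generates]. *)
have piS a i : lcomp (pi a) (V (1, i)) = V (a, i) by rewrite piV mulr1.
have PiS x i : lcomp (Pi x) (V (1, i)) = V' (x, i) by rewrite PiV ract1.
split=> //.
- by split=> i; exact: locop_continuous.
- split=> [i j a|i j x]; first by rewrite piS Vk /= /cnp_kernel /= star1 mul1r.
  by rewrite adj_adj PiS TV'.
- apply: (closed_span_generates Vgen) => -[a i] h.
  by exists i => //; exists a => //; exists h => //; have <- := piS a i.
- apply: (closed_span_generates V'gen) => -[x i] h.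
  by exists i => //; exists x => //; exists h => //; have <- := PiS x i.
Qed.
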